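(* Let $(\pi,X)$ be a covincular pattern. Given a downset $D\subseteq S_{\le n}$ and $d^{-1}$ for each $d\in D$, one can count the $(\pi,X)$-hits in $\tau$ for every $\tau\in D$ in $O(|D|\cdot|\pi|)$ time.
   Context: A permutation in $S_m$ is a word containing each of $1,\dots,m$ exactly once; $S_{\le n}=S_1\cup\dots\cup S_n$. A covincular pattern is a pair $(\pi,X)$ with $\pi\in S_k$ and $X\subseteq\{0,\dots,k\}$. A $(\pi,X)$-hit in $\tau\in S_n$ is a $k$-letter subsequence $a_1\cdots a_k$ of $\tau$ order-isomorphic to $\pi$ such that, writing $b_1<\dots<b_k$ for its letters sorted by value: for each $x\in X$ with $1\le x\le k-1$, $b_{x+1}=b_x+1$; if $0\in X$ then $b_1=1$; and if $k\in X$ then $b_k=n$. A set $D$ of permutations is a downset if for every $\tau\in D$ and every nonempty subword $\tau'$ of $\tau$, the standardization of $\tau'$ (the permutation with the same relative order) lies in $D$. Model of computation: a word RAM in which each permutation of length at most $n$ (letters in fixed-width bit blocks) fits in a constant number of machine words, standard integer and bitwise operations and shifts take constant time, and hash tables keyed by such words support insertion and lookup in constant time. *)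

(* Defs.v *)
From HB Require Import structures.
From mathcomp Require Import all_boot.

Set Implicit Arguments.
Unset Strict Implicit.
Unset Printing Implicit Defensive.

Definition is_perm (m : nat) (s : seq nat) : bool := perm_eq s (iota 1 m).

Definition in_Sle (n : nat) (s : seq nat) : bool :=
  [&& 0 < size s, size s <= n & is_perm (size s) s].

Definition perm_inv (s : seq nat) : seq nat :=
  [seq (index v s).+1 | v <- iota 1 (size s)].

(* Meaningful for words with distinct letters. *)
Definition std (s : seq nat) : seq nat :=
  [seq (count (fun y => y < x) s).+1 | x <- s].

(* A finite set of permutations is given by a duplicate-free enumeration. *)
Definition downset (D : seq (seq nat)) : Prop :=
  forall tau t : seq nat,
    tau \in D -> subseq t tau -> t != [::] -> std t \in D.

Definition order_iso (a p : seq nat) : bool :=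
  (size a == size p) &&
  [forall i : 'I_(size a), forall j : 'I_(size a),
     (nth 0 a i < nth 0 a j) == (nth 0 p i < nth 0 p j)].

(* b_x (1 <= x <= k) is nth 0 b x.-1, where b is the sorted hit. *)
Definition gap_ok (k n x : nat) (b : seq nat) : bool :=
  [&& (x == 0) ==> (nth 0 b 0 == 1),
      (x == k) ==> (nth 0 b k.-1 == n)
    & (0 < x < k) ==> (nth 0 b x == (nth 0 b x.-1).+1)].

Definition is_hit (k : nat) (pi : seq nat) (X : {set 'I_k.+1}) (n : nat)
    (a : seq nat) : bool :=
  order_iso a pi && [forall x in X, gap_ok k n x (sort leq a)].

(* A subsequence is selected by a bit mask on the positions of tau. *)
Definition hits (k : nat) (pi : seq nat) (X : {set 'I_k.+1}) (tau : seq nat)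
    : nat :=
  #|[set m : (size tau).-tuple bool | is_hit pi X (size tau) (mask m tau)]|.

(* A machine word is a natural number below 2 ^ w. The machine has a read-only
   input tape, an output tape, registers, and hash tables. Registers and tables
   are named statically, so that a program uses finitely many of them. A table
   maps keys, which are fixed-length lists of words, to words, and a missing
   key reads as 0; a table with one-word keys is ordinary addressable memory. *)

Inductive binop :=
  | Add | Sub | Mul | Div | Mod
  | And | Or | Xor | Shl | Shr
  | Equal | Less.

Definition eval_op (w : nat) (o : binop) (x y : nat) : nat :=
  match o with
  | Add => (x + y) %% 2 ^ w
  | Sub => (x + (2 ^ w - y)) %% 2 ^ w
  | Mul => (x * y) %% 2 ^ w
  | Div => x %/ y
  | Mod => x %% y
  | And => Nat.land x y
  | Or => Nat.lor x y
  | Xor => Nat.lxor x y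
  | Shl => (x * 2 ^ y) %% 2 ^ w
  | Shr => x %/ 2 ^ y
  | Equal => x == y
  | Less => x < y
  end.

Inductive expr :=
  | Lit of nat
  | Reg of nat
  | Bin of binop & expr & expr.

Inductive cmd :=
  | Skip
  | Assign of nat & expr                    (* register := expr *)
  | Read of nat                             (* register := next input word *)
  | Write of expr
  | Lookup of nat & nat & seq expr          (* register := table[key] *)
  | Insert of nat & seq expr & expr         (* table[key] := expr *)
  | Seq of cmd & cmd
  | If of expr & cmd & cmd
  | While of expr & cmd.

Record state := State {
  regs : nat -> nat;
  tabs : nat -> seq nat -> nat;
  inp : seq nat;
  out : seq nat }.

Definition init_state (input : seq nat) : state :=
  State (fun _ => 0) (fun _ _ => 0) input [::].

Fixpoint eval (w : nat) (s : state) (e : expr) : nat :=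
  match e with
  | Lit v => v %% 2 ^ w
  | Reg x => regs s x
  | Bin o e1 e2 => eval_op w o (eval w s e1) (eval w s e2)
  end.

Definition set_reg (s : state) (x v : nat) : state :=
  State (fun y => if y == x then v else regs s y) (tabs s) (inp s) (out s).

Definition set_tab (s : state) (t : nat) (key : seq nat) (v : nat) : state :=
  State (regs s)
    (fun t' key' => if (t' == t) && (key' == key) then v else tabs s t' key')
    (inp s) (out s).

Fixpoint cost (e : expr) : nat :=
  match e with
  | Lit _ | Reg _ => 1
  | Bin _ e1 e2 => (cost e1 + cost e2).+1
  end.

Definition costs (es : seq expr) : nat := sumn (map cost es).

(* exec w p s t s': on w-bit words, p started in s halts in s' after time t,
   the number of elementary operations performed. A hash-table access is
   charged one unit on top of the evaluation of the words of its key. *)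
Inductive exec (w : nat) : cmd -> state -> nat -> state -> Prop :=
  | ExecSkip s : exec w Skip s 1 s
  | ExecAssign s x e :
      exec w (Assign x e) s (cost e).+1 (set_reg s x (eval w s e))
  | ExecRead s x :
      exec w (Read x) s 1
        (set_reg (State (regs s) (tabs s) (behead (inp s)) (out s))
           x (head 0 (inp s)))
  | ExecWrite s e :
      exec w (Write e) s (cost e).+1
        (State (regs s) (tabs s) (inp s) (rcons (out s) (eval w s e)))
  | ExecLookup s x t key :
      exec w (Lookup x t key) s (costs key).+1
        (set_reg s x (tabs s t (map (eval w s) key)))
  | ExecInsert s t key e :
      exec w (Insert t key e) s (costs key + cost e).+1
        (set_tab s t (map (eval w s) key) (eval w s e))
  | ExecSeq p q s s' s'' t t' :
      exec w p s t s' -> exec w q s' t' s'' ->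
      exec w (Seq p q) s (t + t') s''
  | ExecIfTrue e p q s s' t :
      eval w s e != 0 -> exec w p s t s' ->
      exec w (If e p q) s (cost e + t).+1 s'
  | ExecIfFalse e p q s s' t :
      eval w s e == 0 -> exec w q s t s' ->
      exec w (If e p q) s (cost e + t).+1 s'
  | ExecWhileFalse e p s :
      eval w s e == 0 -> exec w (While e p) s (cost e).+1 s
  | ExecWhileTrue e p s s' s'' t t' :
      eval w s e != 0 -> exec w p s t s' -> exec w (While e p) s' t' s'' ->
      exec w (While e p) s (cost e + t + t').+1 s''.

(* Letters occupy b-bit blocks, w %/ b blocks to a word, first letter in the
   lowest block of the first word; unused blocks are 0. *)
Definition pack (w b c : nat) (s : seq nat) : seq nat :=
  [seq \sum_(r < w %/ b) nth 0 s (j * (w %/ b) + r) * 2 ^ (b * r)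
     | j <- iota 0 c].

Definition digits (w c N : nat) : seq nat :=
  [seq N %/ 2 ^ (w * j) %% 2 ^ w | j <- iota 0 c].

(* The enumeration of D, each d with its length and its inverse, is closed by a
   word 0, which is not a length. X is given by its characteristic vector. *)
Definition input_tape (w b c n k : nat) (pi : seq nat) (X : {set 'I_k.+1})
    (D : seq (seq nat)) : seq nat :=
  [:: w; b; n]
  ++ flatten [seq size d :: pack w b c d ++ pack w b c (perm_inv d) | d <- D]
  ++ 0 :: k :: pi ++ [seq nat_of_bool (x \in X) | x <- enum 'I_k.+1].

(* A count is written on c words; as a permutation of length n fits in c words,
   n <= c * w, so that counts are below 2 ^ (c * w) and nothing is lost. *)
Definition output_tape (w c k : nat) (pi : seq nat) (X : {set 'I_k.+1})
    (D : seq (seq nat)) : seq nat :=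
  flatten [seq digits w c (hits pi X tau) | tau <- D].

(* Main.v *)
Require Import Defs.
From Stdlib Require PeanoNat.
From mathcomp Require Import all_boot zify.
Set Implicit Arguments.
Unset Strict Implicit.
Unset Printing Implicit Defensive.

(** Let [P i tau] be the number of hits of [tau] that use the [i] largest letters
    of [tau]; the number of hits is [P 0 tau].  Splitting on whether the next
    letter [v = L - i] (where [L = size tau]) is used,
      [P i tau = P (i + 1) tau + P i (tau minus v)],
    where the last term is absent if [k - i] is in [X]: a hit that uses the [i]
    largest letters but not [v] violates exactly the constraint [k - i] and
    otherwise stays a hit after deletion of [v].  Finally [P k tau] is 0 or 1, and
    is decided in time [O(k)] from the inverse of [tau], by checking that the
    letters [L - k + pi_1, L - k + pi_2, ...] occur in this order.  As [D] is a
    downset, all values are computed by going through [D] by increasing length,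
    each in constant time: a packed word with the letters above [v] decremented is
    maintained while [i] decreases, and the key of [tau] minus [v] is this word
    with one block cut out.  Permutations are linked into lists, one per length,
    through hash tables keyed by the packed permutations themselves, because
    [size D] need not fit into one machine word. *)

(** * The recurrence for hits that use the largest letters *)

(** Two features keep the cost per step constant. As [i] decreases, [v = L - i] moves up by one, so
    the word with the letters above [v] decremented changes in a single block; the [k] decrements
    that set it up are made by the loop that decides [P k tau]. And loops over the [c] words of a
    vector are unrolled into the program text, so their cost depends on [c] alone. Missing table
    entries read 0, which is the right count for every word shorter than [k]. This includes the
    empty word, which arises by deletion from a permutation of length 1 although a downset does not
    contain it. Its packed form, the zero vector, is no key of a permutation in [D] and so can also
    serve as the null pointer of the lists. Counts are added modulo [2 ^ (c * w)], which is how
    [digits] truncates them, so correctness of the sums needs no bound on the counts. The output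
    follows the input order while the computation follows the lengths, hence two families of
    links. *)

Fixpoint subseqs (s : seq nat) : seq (seq nat) :=
  if s is x :: s' then [seq x :: a | a <- subseqs s'] ++ subseqs s' else [:: [::]].

Lemma mem_subseqs s a : (a \in subseqs s) = subseq a s.
Proof.
elim: s a => [|x s IH] a /=; first by rewrite inE; case: a.
rewrite mem_cat IH; case: a => [|y a].
  by rewrite sub0seq orbT.
case: (eqVneq y x) => [->|ne].
  have -> : (x :: a \in [seq x :: b | b <- subseqs s]) = (a \in subseqs s).
    by apply/mapP/idP => [[b Hb [->]]|Ha] //; exists a.
  rewrite IH; case: (boolP (subseq a s)) => //= /negP H; apply/negP => H2; apply: H.
  by apply: subseq_trans H2; exact: subseq_cons.
case: (boolP (y :: a \in _)) => // /mapP [b _ [E]]; by rewrite E eqxx in ne.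
Qed.

Lemma subseqs_uniq s : uniq s -> uniq (subseqs s).
Proof.
elim: s => //= x s IH /andP [xs /IH us].
rewrite cat_uniq map_inj_uniq ?us ?andbT => [|a b [] //] /=.
apply/hasPn => a; rewrite mem_subseqs => /mem_subseq Ha; apply/mapP => - [b _ E].
by move: (Ha x); rewrite E mem_head (negbTE xs) => /(_ isT).
Qed.

(** Splitting off the first bit of the mask mirrors the recursion of [subseqs], which lists a word
    once for every mask that selects it. *)
Lemma card_masks (P : pred (seq nat)) s :
  #|[set m : (size s).-tuple bool | P (mask m s)]| = count P (subseqs s).
Proof.
elim: s P => [|x s IH] P /=.
  have -> : [set m : 0.-tuple bool | P (mask m [::])] =
            if P [::] then [set: 0.-tuple bool] else set0.
    by apply/setP => m; rewrite inE mask0; case: (P [::]); rewrite inE.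
  by case: (P [::]); rewrite ?cards0 // cardsT card_tuple.
rewrite count_cat count_map -!IH.
pose f (h : bool) (t : (size s).-tuple bool) := [tuple of h :: t].
have fI h : injective (f h) by move=> t t' /(congr1 val) [E]; apply: val_inj.
rewrite -(card_imset _ (fI true)) 
  -(card_imset [set m : (size s).-tuple bool | P (mask m s)] (fI false)).
rewrite -cardsUI; set I := (_ :&: _); have -> : I = set0; last rewrite cards0 addn0.
  apply: disjoint_setI0; rewrite disjoints_subset; apply/subsetP => m /imsetP [t _ ->].
  by rewrite inE; apply/imsetP => - [t' _] /(congr1 val).
apply: eq_card => m; rewrite !inE.
case/tupleP: m => h t; apply/idP/orP.
  by case: h => /= H; [left|right]; apply/imsetP; exists t; rewrite ?inE.
by case=> /imsetP [t' + E]; rewrite E inE.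
Qed.

Lemma count_subseqs_rem (P : pred (seq nat)) v s : uniq s -> v \in s ->
  count (fun a => P a && (v \notin a)) (subseqs s)
  = count P (subseqs (rem v s)).
Proof.
elim: s P => //= x s IH P /andP [xs us]; rewrite inE eq_sym => vs.
rewrite count_cat count_map; case: (eqVneq x v) => [<-|ne].
  rewrite [X in X + _](eq_count (a2 := pred0)) ?count_pred0 ?add0n; last first.
    by move=> a /=; rewrite mem_head andbF.
  apply: eq_in_count => a; rewrite mem_subseqs => /mem_subseq sa.
  by case: (boolP (x \in a)) => [/sa xs'|]; [rewrite xs' in xs|rewrite andbT].
rewrite (negbTE ne) /= in vs *.
rewrite count_cat count_map -!IH //; congr (_ + _); apply: eq_count => a /=.
by rewrite in_cons eq_sym (negbTE ne).
Qed.

Lemma subseqs_map f s : subseqs (map f s) = map (map f) (subseqs s).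
Proof. by elim: s => //= x s ->; rewrite map_cat -!map_comp. Qed.

Definition has_top (i L : nat) (a : seq nat) : bool :=
  all (fun v => v \in a) (iota (L - i).+1 i).

(** On permutations this is the standardization of [tau] without [v] ([std_rem]), in the form that
    block operations can compute. *)
Definition del (v : nat) (tau : seq nat) : seq nat :=
  [seq x - (v < x) | x <- rem v tau].

Lemma mem_perm L tau x : is_perm L tau -> (x \in tau) = (0 < x <= L).
Proof. by move=> /perm_mem ->; rewrite mem_iota; lia. Qed.

Lemma is_perm_uniq L tau : is_perm L tau -> uniq tau.
Proof. by move=> /perm_uniq ->; rewrite iota_uniq. Qed.

Lemma order_iso_map f a p :
  {in a &, forall x y, (f x < f y) = (x < y)} ->
  order_iso (map f a) p = order_iso a p.
Proof.
move=> fm; rewrite /order_iso size_map; case: eqP => //= E.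
apply: eq_forallb => i; apply: eq_forallb => j.
by rewrite !(nth_map 0) // fm // mem_nth.
Qed.

Lemma sort_map_mono f a :
  {in a &, forall x y, (f x <= f y) = (x <= y)} ->
  sort leq (map f a) = map f (sort leq a).
Proof.
move=> fm; apply: (sorted_eq leq_trans anti_leq).
- by apply: sort_sorted; exact: leq_total.
- rewrite sorted_map; apply: (sub_in_sorted (P := mem a) (e := leq)).
  + by move=> x y xa ya /=; rewrite fm.
  + by apply/allP => x; rewrite mem_sort.
  + by apply: sort_sorted; exact: leq_total.
- by rewrite perm_sort perm_map // perm_sym perm_sort.
Qed.

(** Omitting the letter [L - i] separates the small letters from the run of the [i] largest; in this
    form the constraints of [X] can be compared before and after deletion. *)
Lemma sort_top i L a : uniq a -> i <= L -> has_top i L a ->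
  L - i \notin a -> {in a, forall x, x <= L} ->
  sort leq a = filter (fun y => y < L - i) (sort leq a) ++ iota (L - i).+1 i.
Proof.
move=> ua iL /allP top va aL; set v := L - i in top va *.
apply: (irr_sorted_eq ltn_trans ltnn).
- by rewrite ltn_sorted_uniq_leq sort_uniq ua sort_sorted //; exact: leq_total.
- rewrite sorted_pairwise; last exact: ltn_trans.
  rewrite pairwise_cat -!sorted_pairwise; do ?exact: ltn_trans.
  rewrite iota_ltn_sorted sorted_filter ?andbT; do ?exact: ltn_trans.
    apply/allrelP => x y; rewrite mem_filter mem_iota; lia.
  by rewrite ltn_sorted_uniq_leq sort_uniq ua sort_sorted //; exact: leq_total.
- move=> x; rewrite mem_cat mem_filter mem_sort mem_iota.
  apply/idP/idP => [xa|].
    rewrite xa; have := aL _ xa; have : x != v by apply: contraNneq va => <-.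
    by rewrite /v; lia.
  case/orP => [/andP [] //|h]; apply: top; rewrite mem_iota; lia.
Qed.

Lemma size_del v tau : v \in tau -> size (del v tau) = (size tau).-1.
Proof. by move=> h; rewrite size_map size_rem. Qed.

Lemma has_top_del i L a : i < L -> L - i \notin a ->
  has_top i L.-1 [seq x - (L - i < x) | x <- a] = has_top i L a.
Proof.
move=> iL va; rewrite /has_top -(addn1 (L - i)).
have -> : (L.-1 - i).+1 = L - i by lia.
rewrite [in RHS]addnC iotaDl all_map; apply: eq_in_all => y.
rewrite mem_iota /= => hy; apply/mapP/idP => [[x xa E]|h].
  have xv : x != L - i by apply: contraNneq va => <-.
  by have -> : 1 + y = x by lia.
by exists (1 + y) => //; lia.
Qed.

Lemma count_split (T : Type) (P Q : pred T) s :
  count P s = count (fun a => P a && Q a) s + count (fun a => P a && ~~ Q a) s.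
Proof. by elim: s => //= x s ->; case: (P x); case: (Q x) => //=; lia. Qed.

Lemma count_ltn_iota m n x : count (fun y => y < x) (iota m n) = minn (x - m) n.
Proof.
elim: n m => [|n IH] m /=; first by rewrite minn0.
by rewrite IH; case: ltnP; lia.
Qed.

Lemma count_order_iso a p i : order_iso a p -> i < size a ->
  count (fun y => y < nth 0 a i) a = count (fun y => y < nth 0 p i) p.
Proof.
move=> /andP [/eqP sz /forallP H] ia.
have E s x : count (fun y => y < x) s = count (fun j => nth 0 s j < x) (iota 0 (size s)).
  by rewrite -{1}[s](mkseq_nth 0) count_map.
rewrite !E -sz; apply: eq_in_count => j; rewrite mem_iota /= => ja.
by have /forallP /(_ (Ordinal ia)) /eqP := H (Ordinal ja).
Qed.

Lemma sorted_index (T : eqType) (s : seq T) : uniq s ->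
  sorted (fun x y => index x s < index y s) s.
Proof.
move=> us; have : sorted ltn (map (index^~ s) s); last by rewrite sorted_map.
suff -> : map (index^~ s) s = iota 0 (size s) by exact: iota_ltn_sorted.
case: s us => // x0 s0; set s := x0 :: s0 => us.
apply: (@eq_from_nth _ 0); rewrite size_map ?size_iota // => i i_s.
by rewrite (nth_map x0) // index_uniq // nth_iota.
Qed.

(** Both words have the same letters, and a word listed by increasing position in [s] is determined
    by its letters. This turns the base case into a test on the inverse of [tau]. *)
Lemma filter_index_sorted (T : eqType) (p : pred T) (s a : seq T) :
  uniq s -> a =i filter p s ->
  (filter p s == a) = sorted ltn (map (index^~ s) a).
Proof.
move=> us ea; rewrite sorted_map.
pose e := relpre (index^~ s) ltn.
have et : transitive e by move=> x y z; apply: ltn_trans.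
have ei : irreflexive e by move=> x; apply: ltnn.
have sf : sorted e (filter p s) by apply: sorted_filter => //; apply: sorted_index.
apply/eqP/idP => [<-|sa]; first exact: sf.
by apply: (irr_sorted_eq et ei) => // x; rewrite ea.
Qed.

(** * Counting hits that use the [i] largest letters: recurrence and base case *)

Section TopHits.
Variables (k : nat) (pi : seq nat) (X : {set 'I_k.+1}).
Hypotheses (k_gt0 : 0 < k) (pi_perm : is_perm k pi).

Definition top_hits (i : nat) (tau : seq nat) : nat :=
  count (fun a => is_hit pi X (size tau) a && has_top i (size tau) a)
    (subseqs tau).

Lemma hitsE tau : hits pi X tau = top_hits 0 tau.
Proof.
rewrite /hits (card_masks (fun a => is_hit pi X (size tau) a)).
by apply: eq_count => a; rewrite andbT.
Qed.

Lemma size_pi : size pi = k.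
Proof. by rewrite (perm_size pi_perm) size_iota. Qed.

(** This makes the default value 0 of the count table correct for short words. *)
Lemma top_hits_small i tau : size tau < k -> top_hits i tau = 0.
Proof.
move=> lt; rewrite /top_hits (eq_in_count (a2 := pred0)) ?count_pred0 //.
move=> a; rewrite mem_subseqs => /size_subseq le.
rewrite /is_hit /order_iso size_pi.
case: eqP => //= E; exfalso; move: le; rewrite E leqNgt => /negP; exact.
Qed.

(** Deletion of [v] shifts the run above it and the total length down together, so a constraint
    inside [b], inside the run or at either end keeps its truth value. Only [x = k - i] compares
    across [v]: before deletion it fails, because the last letter of [b] is below [v] and must be
    followed by [v + 1] or, if [i = 0], equal the length [v]. *)
Lemma gap_ok_del i v b x : i < k -> size b = k - i -> all (fun y => y < v) b ->
  x <= k ->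
  gap_ok k (v + i) x (b ++ iota v.+1 i) =
  (x != k - i) && gap_ok k (v + i).-1 x (b ++ iota v i).
Proof.
move=> ik sb bv xk.
have nb y : y < k - i -> nth 0 b y < v.
  by move=> h; apply: (allP bv); apply: mem_nth; rewrite sb.
have N1 u y : nth 0 (b ++ iota u i) y =
   if y < k - i then nth 0 b y else if y < k then u + (y - (k - i)) else 0.
  rewrite nth_cat sb; case: ifP => // h; case: ifP => h2.
    by rewrite nth_iota //; lia.
  by rewrite nth_default // size_iota; lia.
rewrite /gap_ok !N1; case: (posnP x) => [->|x0].
  have k0 : (0 == k - i) = false by apply/negbTE; lia.
  have k1 : (0 == k) = false by apply/negbTE; lia.
  have -> : 0 < k - i by lia.
  by rewrite k0 k1.
case: (eqVneq x k) => [->|nk].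
  rewrite ltnn andbF /= !andbT (_ : k.-1 < k); last by lia.
  case: (posnP i) => [i0|i0].
    have := nb k.-1; rewrite i0 subn0 eqxx (_ : k.-1 < k); last by lia.
    move=> /(_ isT) h /=; apply/negbTE; clear -h; lia.
  have -> : (k.-1 < k - i) = false by apply/negbTE; lia.
  have -> : k != k - i by lia.
  by apply/eqP/eqP; lia.
have xk' : x < k by lia.
rewrite xk' (_ : x.-1 < k) /=; last by lia.
case: (ltngtP x (k - i)) => h //=.
- by rewrite (_ : x.-1 < k - i); last by lia.
- have -> : (x.-1 < k - i) = false by apply/negbTE; lia.
  by apply/eqP/eqP; lia.
- rewrite (_ : x.-1 < k - i); last by lia.
  have h2 : nth 0 b x.-1 < v by apply: nb; lia.
  by apply/negbTE; rewrite h subnn addn0 -h; move: h2; clear; lia.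
Qed.

Lemma top_hits_rec i tau : is_perm (size tau) tau -> i < k -> k <= size tau ->
  top_hits i tau = top_hits i.+1 tau +
    (if inord (k - i) \in X then 0 else top_hits i (del (size tau - i) tau)).
Proof.
move=> tp ik kL; set L := size tau; set v := L - i.
have vt : v \in tau by rewrite (mem_perm _ tp) /v -/L; lia.
have ut := is_perm_uniq tp.
rewrite /top_hits -/L (count_split _ (fun a => v \in a)); congr (_ + _).
  apply: eq_count => a; rewrite -andbA /has_top.
  have -> : (L - i.+1).+1 = v by rewrite /v /L; lia.
  by rewrite /= [X in _ && X]andbC.
rewrite count_subseqs_rem // size_del // -/L /del subseqs_map count_map.
have main a : a \in subseqs (rem v tau) ->
    is_hit pi X L a && has_top i L a =
    (inord (k - i) \notin X) && (is_hit pi X L.-1 [seq x - (v < x) | x <- a]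
      && has_top i L.-1 [seq x - (v < x) | x <- a]).
  rewrite mem_subseqs => sa.
  have va : v \notin a.
    by apply/negP => /(mem_subseq sa); rewrite mem_rem_uniq // inE eqxx.
  have ua : uniq a by apply: subseq_uniq sa _; apply: rem_uniq.
  have aL : {in a, forall x, x <= L}.
    by move=> x /(mem_subseq sa) /mem_rem; rewrite (mem_perm _ tp) => /andP [].
  have nv x : x \in a -> x != v by move=> xa; apply: contraNneq va => <-.
  rewrite has_top_del //; last by rewrite /L; lia.
  case: (boolP (has_top i L a)) => top; rewrite ?andbF // !andbT /is_hit.
  rewrite order_iso_map; last by move=> x y /nv + /nv; lia.
  rewrite sort_map_mono; last by move=> x y /nv + /nv; lia.
  case: (boolP (order_iso a pi)) => [/andP [/eqP sz _]|]; rewrite ?andbF //=.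
  rewrite size_pi in sz.
  (* The sorted word is [b], the [k - i] letters below [v], followed by the run above [v]; deletion
     fixes [b] and lowers the run by one, as [gap_ok_del] expects. *)
  have := sort_top ua _ top va aL; rewrite -/v => -> //; last by rewrite /L; lia.
  set b := filter _ _.
  have bv : all (fun y => y < v) b by apply: filter_all.
  have sb : size b = k - i.
    have := congr1 size (sort_top ua (_ : i <= L) top va aL).
    by rewrite size_sort size_cat size_iota sz -/v -/b => -> //; rewrite /L; lia.
  rewrite map_cat (_ : map _ b = b); last first.
    by apply: map_id_in => x /(allP bv) /= h; lia.
  rewrite (_ : map _ (iota _ _) = iota v i); last first.
    rewrite -(addn1 v) addnC iotaDl -map_comp; apply: map_id_in => y.
    by rewrite mem_iota /=; lia.
  have eL : L = v + i by rewrite /v /L; lia.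
  rewrite {1 2}eL.
  apply/forall_inP/andP => [H|[nX /forall_inP H] x xX].
    split.
      apply/negP => /H; rewrite gap_ok_del ?inordK ?ltnS ?leq_subr ?eqxx //.
    by apply/forall_inP => x /H; rewrite gap_ok_del ?leq_ord // => /andP [].
  rewrite gap_ok_del ?leq_ord //; apply/andP; split; last exact: H.
  apply: contraNneq nX => E; suff -> : inord (k - i) = x by [].
  by apply: val_inj; rewrite /= inordK -?E.
rewrite (eq_in_count main); case: (inord _ \in X) => /=.
  by rewrite count_pred0.
by apply: eq_count.
Qed.

(** In a word on [k] consecutive values a letter is determined by its rank, and the ranks are those
    of [pi]. *)
Lemma order_iso_shift m a : perm_eq a (iota m.+1 k) ->
  order_iso a pi = (a == [seq m + y | y <- pi]).
Proof.
move=> pa; have sa : size a = k by rewrite (perm_size pa) size_iota.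
have ma x : (x \in a) = (m < x <= m + k).
  by rewrite (perm_mem pa) mem_iota; lia.
apply/idP/eqP => [oi|->]; last first.
  rewrite order_iso_map => [|x y _ _]; last by rewrite ltn_add2l.
  by rewrite /order_iso eqxx; apply/forallP => i; apply/forallP => j.
apply: (@eq_from_nth _ 0); rewrite ?size_map ?sa ?size_pi // => i ik.
rewrite (nth_map 0) ?size_pi //.
have := count_order_iso oi; rewrite sa => /(_ i ik).
have /permP -> := pa; have /permP -> := pi_perm; rewrite !count_ltn_iota.
have : nth 0 a i \in a by rewrite mem_nth // sa.
have : nth 0 pi i \in pi by rewrite mem_nth // size_pi.
by rewrite ma (mem_perm _ pi_perm); clear; lia.
Qed.

(** The only candidate is [a0], the subword of the [k] largest letters. Its values are consecutive
    and end at the length of [tau], so the only constraint that can fail is the one at 0, which asks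
    that the smallest of them be 1. *)
Lemma top_hits_base tau : is_perm (size tau) tau -> k <= size tau ->
  top_hits k tau =
  ((inord 0 \in X) ==> (size tau == k))
  && sorted ltn [seq index (size tau - k + y) tau | y <- pi] :> nat.
Proof.
move=> tp kL; set L := size tau; set m := L - k.
have ut := is_perm_uniq tp.
pose a0 := filter (fun x => m < x) tau.
have ma0 x : (x \in a0) = (m < x <= m + k).
  by rewrite mem_filter (mem_perm _ tp) /m /L; move: kL; clear; lia.
have p0 : perm_eq a0 (iota m.+1 k).
  apply: uniq_perm; rewrite ?iota_uniq ?filter_uniq // => x.
  by rewrite ma0 mem_iota; clear; lia.
have sort0 : sort leq a0 = iota m.+1 k.
  apply: (sorted_eq leq_trans anti_leq); rewrite ?iota_sorted //.
    by apply: sort_sorted; exact: leq_total.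
  by rewrite perm_sort.
have hit0 : is_hit pi X L a0 = ((inord 0 \in X) ==> (L == k))
  && sorted ltn [seq index (m + y) tau | y <- pi].
  rewrite /is_hit sort0 (order_iso_shift p0) andbC; congr (_ && _); last first.
    rewrite filter_index_sorted // -?map_comp // => x.
    rewrite ma0; apply/mapP/idP => [[y] |h].
      by rewrite (mem_perm _ pi_perm) => h ->; move: h; clear; lia.
    by exists (x - m); rewrite ?(mem_perm _ pi_perm); move: h; clear; lia.
  have nk x : x < k -> nth 0 (iota m.+1 k) x = m.+1 + x by move=> h; rewrite nth_iota.
  apply/forall_inP/implyP => [H X0|H x xX].
    have /and3P [+ _ _] := H _ X0; rewrite inordK //= nk // /m /L.
    by move: kL; clear; lia.
  apply/and3P; split; apply/implyP => h.
  - have E : x = inord 0 by apply: val_inj; rewrite /= inordK // (eqP h).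
    by rewrite nk // /m (eqP (H _)) -?E // subnn.
  - by rewrite nk /m /L; move: kL k_gt0; clear; lia.
  - rewrite !nk; move: h; clear; try lia; by case: (nat_of_ord x) => //= y; lia.
rewrite -hit0 /top_hits -/L.
rewrite (eq_in_count (a2 := fun a => is_hit pi X L a0 && (a == a0))).
  case: (is_hit pi X L a0) => /=; last by rewrite count_pred0.
  have -> : count (fun a => a == a0) (subseqs tau) = count_mem a0 (subseqs tau).
    by apply: eq_count.
  rewrite count_uniq_mem ?subseqs_uniq // mem_subseqs.
  by rewrite filter_subseq.
move=> a; rewrite mem_subseqs => sa.
case: (eqVneq a a0) => [->|ne]; last rewrite andbF.
  rewrite andbT; case: is_hit => //=; rewrite -/m; apply/allP => x.
  by rewrite mem_iota ma0; clear; lia.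
apply/negbTE/negP => /andP [/andP [/andP [/eqP sz _] _] /allP top].
case/eqP: ne; have /subseq_uniqP -> // := sa; apply: eq_in_filter => x xt.
(* A [k]-letter word that contains the [k] largest letters has no other letters, so as a subsequence
   of [tau] it is [a0]. *)
have le : size a <= size (iota m.+1 k) by rewrite size_iota sz size_pi.
have [_ <-] := uniq_min_size (iota_uniq m.+1 k) top le.
rewrite mem_iota; move: xt; rewrite (mem_perm _ tp) /m /L; move: kL; clear; lia.
Qed.
End TopHits.

Lemma nth_perm_inv s v : 0 < v <= size s ->
  nth 0 (perm_inv s) v.-1 = (index v s).+1.
Proof.
case: v => // v /= h; rewrite (nth_map 0) ?size_iota // nth_iota //.
Qed.

Lemma std_rem tau v : is_perm (size tau) tau -> v \in tau ->
  std (rem v tau) = del v tau.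
Proof.
move=> tp vt; apply/eq_in_map => x xr.
have xt : x \in tau by apply: mem_rem xr.
have nx : x != v by move: xr; rewrite (mem_rem_uniq v (is_perm_uniq tp)) inE => /andP [].
rewrite count_rem vt /=; have /permP -> := tp; rewrite count_ltn_iota.
move: xt vt; rewrite !(mem_perm _ tp); move: nx; clear; lia.
Qed.

(** * Packed words *)

(** The number with base-[B] digits [f 0], [f 1], ..., lowest first. *)
Definition poly (B : nat) (f : nat -> nat) (n : nat) := \sum_(r < n) f r * B ^ r.

Lemma poly_cat B f m n : poly B f (m + n) = poly B f m + poly B (fun r => f (m + r)) n * B ^ m.
Proof.
rewrite /poly big_split_ord /= big_distrl; congr (_ + _).
by apply: eq_bigr => i _; rewrite expnD mulnA mulnAC.
Qed.

Lemma poly_lt B f n : (forall r, r < n -> f r < B) -> poly B f n < B ^ n.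
Proof.
elim: n => [|n IH] h; first by rewrite /poly big_ord0.
rewrite /poly big_ord_recr /= -/(poly B f n) expnS.
have := IH (fun r hr => h r (ltnW hr)); have := h n (ltnSn n).
move: (poly _ _ _) (B ^ n) => p q; nia.
Qed.

Lemma poly_mod B f m n : (forall r, r < m -> f r < B) ->
  poly B f (m + n) %% B ^ m = poly B f m.
Proof.
by move=> h; rewrite poly_cat addnC modnMDl modn_small // poly_lt.
Qed.

Lemma poly_div B f m n : (forall r, r < m -> f r < B) ->
  poly B f (m + n) %/ B ^ m = poly B (fun r => f (m + r)) n.
Proof.
move=> h; have lt := poly_lt h; rewrite poly_cat addnC divnMDl ?divn_small ?addn0 //.
by apply: leq_ltn_trans lt.
Qed.

Lemma eq_poly B f g n : (forall r, r < n -> f r = g r) -> poly B f n = poly B g n.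
Proof. by move=> h; apply: eq_bigr => i _; rewrite h. Qed.

Lemma poly_coef B f n r : (forall r, f r < B) -> r < n ->
  poly B f n %/ B ^ r %% B = f r.
Proof.
move=> h rn; have -> : n = r + (1 + (n - r.+1)) by lia.
rewrite poly_div // -{2}(expn1 B) poly_mod //.
by rewrite /poly big_ord_recl big_ord0 muln1 !addn0.
Qed.

(** * Letters as blocks of words: reading, incrementing, deleting *)

Section Blocks.
Variables (b B : nat).
Hypotheses (B_gt0 : 0 < B).

(* [blk s j] is the [j]-th word of the packed representation of [s]. *)
Definition blk (s : seq nat) (j : nat) : nat :=
  poly (2 ^ b) (fun r => nth 0 s (j * B + r)) B.

Definition letters_fit (s : seq nat) := all (fun x => x < 2 ^ b) s.

Lemma letters_fit_nth s i : letters_fit s -> nth 0 s i < 2 ^ b.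
Proof.
move=> h; case: (ltnP i (size s)) => [lt|le]; first exact: (all_nthP 0 h).
by rewrite nth_default // expn_gt0.
Qed.

Lemma blk_lt s j : letters_fit s -> blk s j < 2 ^ (b * B).
Proof. by move=> h; rewrite expnM; apply: poly_lt => r _; apply: letters_fit_nth. Qed.

Lemma blk_get s j r : letters_fit s -> r < B ->
  blk s j %/ 2 ^ (b * r) %% 2 ^ b = nth 0 s (j * B + r).
Proof.
move=> h rB; rewrite expnM /blk (@poly_coef _ (fun r => nth 0 s (j * B + r))) //.
by move=> r'; apply: letters_fit_nth.
Qed.

(** [blk] is linear in the letters, so no bound on them is involved. Read from right to left, the
    equation also justifies decrements. *)
Lemma blk_add s s' q j : (forall m, nth 0 s' m = nth 0 s m + (m == q)) ->
  blk s' j = blk s j + (if j * B <= q < j * B + B then 2 ^ (b * (q - j * B)) else 0).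
Proof.
move=> E; rewrite /blk /poly.
rewrite (eq_bigr (fun r : 'I_B => nth 0 s (j * B + r) * (2 ^ b) ^ r
   + (j * B + r == q) * (2 ^ b) ^ r)); last by move=> r _; rewrite E mulnDl.
rewrite big_split /=; congr (_ + _); case: ifP => [/andP [h1 h2]|h].
  have lt : q - j * B < B by lia.
  rewrite (bigD1 (Ordinal lt)) //= subnKC // eqxx mul1n expnM big1 ?addn0 //.
  move=> r /eqP ne; case: eqP => // e; case: ne; apply: val_inj => /=; lia.
by apply: big1 => r _; case: eqP => // e; have := ltn_ord r; lia.
Qed.

Lemma blk_delete s s' q j : letters_fit s -> q < j * B + B ->
  (forall m, nth 0 s' m = nth 0 s (m + (q <= m))) ->
  let o := q - j * B in
  blk s' j = blk s j %% 2 ^ (b * o) + (blk s j %/ 2 ^ (b * o.+1)) * 2 ^ (b * o)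
    + (blk s j.+1 %% 2 ^ b) * 2 ^ (b * B.-1).
Proof.
move=> h hq E o; have oB : o < B by rewrite /o; move: hq B_gt0; clear; lia.
have fl i : nth 0 s i < 2 ^ b by apply: letters_fit_nth.
have := @blk_get s j.+1 0 h B_gt0; rewrite muln0 divn1 addn0 => ->.
set f := fun r => nth 0 s (j * B + r).
have bs : blk s j = poly (2 ^ b) f B by [].
rewrite bs !expnM; set m := B - o.+1.
have eB1 : B = o + (1 + m) by rewrite /m; move: oB; clear; lia.
have eB2 : B = o.+1 + m by rewrite /m; move: oB; clear; lia.
have -> : poly (2 ^ b) f B %% (2 ^ b) ^ o = poly (2 ^ b) f o.
  by rewrite [X in poly _ _ X]eB1 poly_mod // => r _; apply: fl.
have -> : poly (2 ^ b) f B %/ (2 ^ b) ^ o.+1 = poly (2 ^ b) (fun r => f (o.+1 + r)) m.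
  by rewrite [X in poly _ _ X]eB2 poly_div // => r _; apply: fl.
have -> : blk s' j = poly (2 ^ b) (fun r => f (r + (o <= r))) (o + (m + 1)).
  rewrite /blk (addnC m) -eB1; apply: eq_poly => r rB.
  rewrite E /f addnA; congr (nth 0 s (_ + nat_of_bool _)).
  by rewrite /o; clear; lia.
rewrite poly_cat -addnA; congr (_ + _).
  by apply: eq_poly => r ro; rewrite leqNgt ro addn0.
rewrite poly_cat mulnDl; congr (_ + _).
  congr (_ * _); apply: eq_poly => r _; congr f; lia.
rewrite /poly big_ord_recl big_ord0 /= !addn0 muln1 -mulnA -expnD.
have -> : m + o = B.-1 by rewrite /m; move: oB; clear; lia.
by rewrite /f; congr (nth 0 s _ * _); rewrite /m; move: oB; clear; lia.
Qed.

Lemma blk_before s s' q j : j * B + B <= q ->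
  (forall m, nth 0 s' m = nth 0 s (m + (q <= m))) -> blk s' j = blk s j.
Proof.
move=> h E; apply: eq_poly => r rB; rewrite E; congr nth; lia.
Qed.

Definition pk (c : nat) (s : seq nat) := [seq blk s j | j <- iota 0 c].

Lemma pk_inj c s s' : letters_fit s -> letters_fit s' ->
  0 \notin s -> 0 \notin s' -> size s <= c * B -> size s' <= c * B ->
  pk c s = pk c s' -> s = s'.
Proof.
move=> h h' p p' z z' E.
have En i : i < c * B -> nth 0 s i = nth 0 s' i.
  move=> ic; rewrite (divn_eq i B).
  have jc : i %/ B < c by rewrite ltn_divLR.
  have rB : i %% B < B by rewrite ltn_mod.
  rewrite -(blk_get _ h rB) -(blk_get _ h' rB).
  have := congr1 (fun t => nth 0 t (i %/ B)) E.
  by rewrite !(nth_map 0) ?size_iota // nth_iota // => ->.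
have sz : size s = size s'.
  apply/eqP; rewrite eqn_leq; apply/andP; split; rewrite leqNgt; apply/negP => lt.
    have := mem_nth 0 lt; rewrite En ?nth_default ?(negbTE p) //.
    by apply: leq_trans lt z.
  have := mem_nth 0 lt; rewrite -En ?nth_default ?(negbTE p') //.
  by apply: leq_trans lt z'.
by apply: (eq_from_nth sz) => i hi; apply: En; apply: leq_trans hi z.
Qed.

Lemma pk_nil c : pk c [::] = nseq c 0.
Proof.
apply: (@eq_from_nth _ 0); rewrite size_map size_iota ?size_nseq // => j jc.
rewrite (nth_map 0) ?size_iota // nth_nseq jc /blk /poly big1 // => r _.
by rewrite nth_nil.
Qed.
End Blocks.

Lemma packE w b c s : pack w b c s = pk b (w %/ b) c s.
Proof.
apply: eq_map => j; apply: eq_bigr => r _; by rewrite expnM.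
Qed.

(** * Loop-free commands, loops and vectors of registers *)

Fixpoint straight (p : cmd) : bool :=
  match p with
  | Seq p q | If _ p q => straight p && straight q
  | While _ _ => false
  | _ => true
  end.

(** A functional semantics lets the effect of loop-free code be computed step by step. The value at
    [While] is a dummy, excluded by [straight]. *)
Fixpoint den (w : nat) (p : cmd) (s : state) : state :=
  match p with
  | Skip | While _ _ => s
  | Assign x e => set_reg s x (eval w s e)
  | Read x =>
      set_reg (State (regs s) (tabs s) (behead (inp s)) (out s)) x (head 0 (inp s))
  | Write e => State (regs s) (tabs s) (inp s) (rcons (out s) (eval w s e))
  | Lookup x t key => set_reg s x (tabs s t (map (eval w s) key))
  | Insert t key e => set_tab s t (map (eval w s) key) (eval w s e)
  | Seq p q => den w q (den w p s)
  | If e p q => if eval w s e != 0 then den w p s else den w q s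
  end.

Fixpoint max_time (p : cmd) : nat :=
  match p with
  | Skip | Read _ => 1
  | While _ _ => 0
  | Assign _ e | Write e => (cost e).+1
  | Lookup _ _ key => (costs key).+1
  | Insert _ key e => (costs key + cost e).+1
  | Seq p q => max_time p + max_time q
  | If e p q => (cost e + maxn (max_time p) (max_time q)).+1
  end.

Definition runs w p T s (Q : state -> Prop) :=
  exists t s', [/\ exec w p s t s', t <= T & Q s'].

Definition wp w p s (Q : state -> Prop) := Q (den w p s).

Lemma runs_straight w p s Q : straight p -> wp w p s Q -> runs w p (max_time p) s Q.
Proof.
move=> sp H; suff [t [ex le]] : exists t, exec w p s t (den w p s) /\ t <= max_time p.
  by exists t, (den w p s).
elim: p s sp {H} => /=; try by move=> *; eexists; split; [constructor|].
- move=> p IHp q IHq s /andP [/(IHp s) [t [e1 l1]] /(IHq (den w p s)) [t' [e2 l2]]].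
  by exists (t + t'); split; [apply: ExecSeq e1 e2|apply: leq_add].
- move=> e p IHp q IHq s /andP [/(IHp s) [t [e1 l1]] /(IHq s) [t' [e2 l2]]].
  case: eqP => [/eqP e0|/eqP e0].
    exists (cost e + t').+1; split; first exact: ExecIfFalse.
    by rewrite ltnS leq_add2l leq_max l2 orbT.
  exists (cost e + t).+1; split; first exact: ExecIfTrue.
  by rewrite ltnS leq_add2l leq_max l1.
Qed.

Lemma runs_weaken w p T T' s (Q Q' : state -> Prop) :
  runs w p T s Q -> T <= T' -> (forall s', Q s' -> Q' s') -> runs w p T' s Q'.
Proof.
move=> [t [s' [ex le q]]] TT QQ; exists t, s'; split=> //; last exact: QQ.
exact: leq_trans TT.
Qed.

Lemma runs_seq w p q T T' s Q :
  runs w p T s (fun s1 => runs w q T' s1 Q) -> runs w (Seq p q) (T + T') s Q.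
Proof.
move=> [t [s1 [e1 l1 [t' [s2 [e2 l2 H]]]]]]; exists (t + t'), s2; split=> //.
  exact: ExecSeq e1 e2.
exact: leq_add.
Qed.

Lemma runs_if w e p q T s Q :
  (eval w s e != 0 -> runs w p T s Q) -> (eval w s e = 0 -> runs w q T s Q) ->
  runs w (If e p q) (cost e + T).+1 s Q.
Proof.
move=> h1 h2; case: (boolP (eval w s e != 0)) => [e0|/negPn e0].
  case: (h1 e0) => t [s' [ex le H]]; exists (cost e + t).+1, s'; split=> //.
    exact: ExecIfTrue.
  by rewrite ltnS leq_add2l.
case: (h2 (eqP e0)) => t [s' [ex le H]]; exists (cost e + t).+1, s'; split=> //.
  exact: ExecIfFalse.
by rewrite ltnS leq_add2l.
Qed.

(** The invariant is indexed by the number of iterations left, so one induction yields both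
    termination and the time bound. Later invariants accordingly describe [k - m] completed
    iterations. *)
Lemma runs_while w e p T (I : nat -> state -> Prop) :
  (forall m s, I m.+1 s -> eval w s e != 0 /\ runs w p T s (I m)) ->
  (forall s, I 0 s -> eval w s e = 0) ->
  forall m s, I m s ->
  runs w (While e p) (m * (cost e + T).+1 + (cost e).+1) s (I 0).
Proof.
move=> step stop; elim=> [|m IH] s Is.
  exists (cost e).+1, s; split=> //; apply: ExecWhileFalse; exact/eqP/stop.
have [e0 [t [s1 [ex le /IH [t' [s' [ex' le' H]]]]]]] := step _ _ Is.
exists (cost e + t + t').+1, s'; split=> //; first exact: ExecWhileTrue ex ex'.
by move: le le'; clear; nia.
Qed.

(* Registers and tables come in families: member [j] of family [f]. *)
Definition enc (f j : nat) : nat := pickle (f, j).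
Arguments enc : simpl never.

Lemma eq_enc f j g i : (enc f j == enc g i) = (f == g) && (j == i).
Proof. by rewrite (inj_eq (pcan_inj pickleK)). Qed.

Definition rg (s : state) f j := regs s (enc f j).
Definition RV f j := Reg (enc f j).
Definition R f := RV f 0.

Lemma wp_seq w p q s Q :
  wp w p s (fun s1 => wp w q s1 Q) -> wp w (Seq p q) s Q.
Proof. by []. Qed.

Lemma wp_if w e p q s Q :
  (eval w s e != 0 -> wp w p s Q) -> (eval w s e = 0 -> wp w q s Q) ->
  wp w (If e p q) s Q.
Proof.
by move=> h1 h2; rewrite /wp /=; case: eqP => [/h2|/eqP/h1].
Qed.

Lemma wp_assign w f e s (Q : state -> Prop) :
  (forall s', (forall g i, rg s' g i = if (g == f) && (i == 0) then eval w s e else rg s g i) ->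
     tabs s' = tabs s -> inp s' = inp s -> out s' = out s -> Q s') ->
  wp w (Assign (enc f 0) e) s Q.
Proof. by apply=> // g i; rewrite /rg /= eq_enc. Qed.

Lemma wp_read w f s (Q : state -> Prop) :
  (forall s', (forall g i, rg s' g i = if (g == f) && (i == 0) then head 0 (inp s) else rg s g i) ->
     tabs s' = tabs s -> inp s' = behead (inp s) -> out s' = out s -> Q s') ->
  wp w (Read (enc f 0)) s Q.
Proof. by apply=> // g i; rewrite /rg /= eq_enc. Qed.

Lemma wp_lookup w f t key s (Q : state -> Prop) :
  (forall s', (forall g i, rg s' g i =
       if (g == f) && (i == 0) then tabs s (enc t 0) (map (eval w s) key) else rg s g i) ->
     tabs s' = tabs s -> inp s' = inp s -> out s' = out s -> Q s') ->
  wp w (Lookup (enc f 0) (enc t 0) key) s Q.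
Proof. by apply=> // g i; rewrite /rg /= eq_enc. Qed.

Lemma wp_insert w t key e s (Q : state -> Prop) :
  (forall s', (forall g i, rg s' g i = rg s g i) ->
     (forall u i K, tabs s' (enc u i) K =
       if [&& u == t, i == 0 & K == map (eval w s) key] then eval w s e
       else tabs s (enc u i) K) ->
     inp s' = inp s -> out s' = out s -> Q s') ->
  wp w (Insert (enc t 0) key e) s Q.
Proof. by apply=> // u i K; rewrite /= eq_enc andbA. Qed.

Section Vectors.
Variable c : nat.

Definition vec (f : nat -> nat) := [seq f j | j <- iota 0 c].

Lemma eq_vec f g : (forall j, j < c -> f j = g j) -> vec f = vec g.
Proof. by move=> h; apply/eq_in_map => j; rewrite mem_iota => /h. Qed.

Lemma nth_vec f j : j < c -> nth 0 (vec f) j = f j.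
Proof. by move=> h; rewrite (nth_map 0) ?size_iota // nth_iota. Qed.

(** The index [j] exists only in the program text, because registers are named statically. *)
Definition vseq (body : nat -> cmd) :=
  foldr (fun j p => Seq (body j) p) Skip (iota 0 c).

Lemma straight_vseq body : (forall j, straight (body j)) -> straight (vseq body).
Proof. by move=> h; rewrite /vseq; elim: (iota _ _) => //= j l ->; rewrite h. Qed.

Lemma den_vseq w body (I : nat -> state -> Prop) s :
  (forall j s, j < c -> I j s -> I j.+1 (den w (body j) s)) ->
  I 0 s -> I c (den w (vseq body) s).
Proof.
move=> step; have gen n : forall m s, m + n <= c -> I m s ->
    I (m + n) (den w (foldr (fun j p => Seq (body j) p) Skip (iota m n)) s).
  elim: n => [|n IH] m s' mc Is /=; first by rewrite addn0.
  by rewrite addnS -addSn; apply: IH; [lia|apply: step => //; lia].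
exact: (gen c 0 s (leqnn _)).
Qed.

Definition vassign f (e : nat -> expr) := vseq (fun j => Assign (enc f j) (e j)).
Definition vread f := vseq (fun j => Read (enc f j)).
Definition vwrite (e : nat -> expr) := vseq (fun j => Write (e j)).
Definition vlookup f t key := vseq (fun j => Lookup (enc f j) (enc t j) key).
Definition vinsert t key (e : nat -> expr) := vseq (fun j => Insert (enc t j) key (e j)).
Definition keys f := [seq RV f j | j <- iota 0 c].

Lemma eval_keys w s f : map (eval w s) (keys f) = vec (rg s f).
Proof. by rewrite /keys -map_comp. Qed.

(** When member [j] is assigned, the lower members of [f] are already overwritten. In-place updates
    that read [f] at [j] are thus allowed, whereas sums, whose carries read lower words, go through
    [vsum]. *)
Lemma wp_vassign w f e v s (Q : state -> Prop) :
  (forall j s1, j < c -> (forall g i, (g != f) || (j <= i) -> rg s1 g i = rg s g i) ->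
     eval w s1 (e j) = v j) ->
  (forall s', (forall g i, rg s' g i = if (g == f) && (i < c) then v i else rg s g i) ->
     tabs s' = tabs s -> inp s' = inp s -> out s' = out s -> Q s') ->
  wp w (vassign f e) s Q.
Proof.
move=> he HQ; pose I m s1 := [/\ forall g i, rg s1 g i =
   if (g == f) && (i < m) then v i else rg s g i,
   tabs s1 = tabs s, inp s1 = inp s & out s1 = out s].
have [] : I c (den w (vassign f e) s); last by move=> *; apply: HQ.
apply: den_vseq => [j s1 jc [Ir It Ii Io]|]; last first.
  by split=> // g i; rewrite andbF.
split=> // g i; rewrite /rg /= eq_enc; case: (eqVneq g f) => [->|ne] /=.
  case: eqP => [->|ni].
    rewrite ltnSn; apply: he => // g' i' h; rewrite Ir; case: ifP => // /andP [/eqP e1 e2].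
    by move: h; rewrite e1 eqxx leqNgt e2.
  rewrite -/(rg s1 f i) Ir eqxx ltnS (leq_eqVlt i); by move/eqP/negbTE: ni => ->.
by rewrite -/(rg s1 g i) Ir (negbTE ne).
Qed.

(** The key is evaluated anew for each word and so must not read [f]; this is why successors are
    fetched into [vq] and then copied to [vT]. *)
Lemma wp_vlookup w f t key K s (Q : state -> Prop) :
  (forall s1, (forall g i, g != f -> rg s1 g i = rg s g i) -> map (eval w s1) key = K) ->
  (forall s', (forall g i, rg s' g i =
       if (g == f) && (i < c) then tabs s (enc t i) K else rg s g i) ->
     tabs s' = tabs s -> inp s' = inp s -> out s' = out s -> Q s') ->
  wp w (vlookup f t key) s Q.
Proof.
move=> he HQ; pose I m s1 := [/\ forall g i, rg s1 g i =
   if (g == f) && (i < m) then tabs s (enc t i) K else rg s g i,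
   tabs s1 = tabs s, inp s1 = inp s & out s1 = out s].
have [] : I c (den w (vlookup f t key) s); last by move=> *; apply: HQ.
apply: den_vseq => [j s1 jc [Ir It Ii Io]|]; last first.
  by split=> // g i; rewrite andbF.
split=> // g i; rewrite /rg /= eq_enc; case: (eqVneq g f) => [->|ne] /=.
  case: eqP => [->|ni].
    rewrite ltnSn It he // => g' i' h; rewrite Ir; case: ifP => // /andP [/eqP e1 e2].
    by move: h; rewrite e1 eqxx.
  rewrite -/(rg s1 f i) Ir eqxx ltnS (leq_eqVlt i); by move/eqP/negbTE: ni => ->.
by rewrite -/(rg s1 g i) Ir (negbTE ne).
Qed.

Lemma eval_regs w s s' e : regs s' = regs s -> eval w s' e = eval w s e.
Proof. by move=> h; elim: e => //= [x|o e1 -> e2 ->]; rewrite ?h. Qed.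

Lemma wp_vinsert w t key e s (Q : state -> Prop) :
  (forall s', (forall g i, rg s' g i = rg s g i) ->
     (forall u i K, tabs s' (enc u i) K =
       if [&& u == t, i < c & K == map (eval w s) key] then eval w s (e i)
       else tabs s (enc u i) K) ->
     inp s' = inp s -> out s' = out s -> Q s') ->
  wp w (vinsert t key e) s Q.
Proof.
move=> HQ; pose I m s1 := [/\ regs s1 = regs s, forall u i K, tabs s1 (enc u i) K =
       if [&& u == t, i < m & K == map (eval w s) key] then eval w s (e i)
       else tabs s (enc u i) K, inp s1 = inp s & out s1 = out s].
have [] : I c (den w (vinsert t key e) s).
  apply: den_vseq => [j s1 jc [Ir It Ii Io]|]; last first.
    by split=> // g i K; rewrite andbF.
  split=> // u i K; rewrite /= eq_enc (eval_regs _ _ Ir).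
  rewrite (eq_map (fun x => eval_regs w x Ir)) It.
  case: (eqVneq u t) => [->|ne] //=.
  rewrite ltnS (leq_eqVlt i); case: eqP => [->|ni] //=.
  by rewrite ltnn /=.
by move=> h *; apply: HQ => // g i; rewrite /rg h.
Qed.

Lemma wp_vread w f s (Q : state -> Prop) :
  (forall s', (forall g i, rg s' g i =
       if (g == f) && (i < c) then nth 0 (inp s) i else rg s g i) ->
     tabs s' = tabs s -> inp s' = drop c (inp s) -> out s' = out s -> Q s') ->
  wp w (vread f) s Q.
Proof.
move=> HQ; pose I m s1 := [/\ forall g i, rg s1 g i =
   if (g == f) && (i < m) then nth 0 (inp s) i else rg s g i,
   tabs s1 = tabs s, inp s1 = drop m (inp s) & out s1 = out s].
have [] : I c (den w (vread f) s); last by move=> *; apply: HQ.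
apply: den_vseq => [j s1 jc [Ir It Ii Io]|]; last first.
  by split=> // [g i|]; rewrite ?andbF ?drop0.
split=> //=; last by rewrite Ii -drop1 drop_drop.
move=> g i; rewrite /rg /= eq_enc; case: (eqVneq g f) => [->|ne] /=.
  case: eqP => [->|ni]; first by rewrite ltnSn Ii -nth0 nth_drop addn0.
  rewrite -/(rg s1 f i) Ir eqxx ltnS (leq_eqVlt i); by move/eqP/negbTE: ni => ->.
by rewrite -/(rg s1 g i) Ir (negbTE ne).
Qed.

Lemma wp_vwrite w e s (Q : state -> Prop) :
  (forall s', (forall g i, rg s' g i = rg s g i) -> tabs s' = tabs s ->
     inp s' = inp s -> out s' = out s ++ vec (fun j => eval w s (e j)) -> Q s') ->
  wp w (vwrite e) s Q.
Proof.
move=> HQ; pose I m s1 := [/\ regs s1 = regs s, tabs s1 = tabs s, inp s1 = inp s &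
   out s1 = out s ++ [seq eval w s (e j) | j <- iota 0 m]].
have [] : I c (den w (vwrite e) s).
  apply: den_vseq => [j s1 jc [Ir It Ii Io]|]; last by split; rewrite // cats0.
  split=> //; rewrite -(addn1 j) iotaD map_cat /= Io (eval_regs _ _ Ir) add0n.
  by rewrite -cats1 catA.
by move=> h *; apply: HQ => // g i; rewrite /rg h.
Qed.
End Vectors.

(** * Word-level expressions *)

Local Notation rb := 0 (only parsing).
Local Notation rB := 1 (only parsing).

Definition esat e1 e2 := Bin Mul (Bin Less e2 e1) (Bin Defs.Sub e1 e2).
(** Reduction modulo [2 ^ e2], in a form that does not compute this power and stays correct when
    [e2] is the word width. *)
Definition elow e1 e2 := Bin Defs.Sub e1 (Bin Shl (Bin Shr e1 e2) e2).

(* Positions [p] count from 1.  [eoff p j] is [p - j * B] in truncated subtraction,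
   so that block [p] lies in word [j] iff it is between 1 and [B]; literals [j] are
   avoided, as they would be reduced modulo [2 ^ w]. *)
Definition eoff (p : expr) (j : nat) := iter j (fun e => esat e (R rB)) p.
Definition eord p j := esat (eoff p j) (Lit 1).
Definition ein p j :=
  Bin Mul (Bin Less (Lit 0) (eoff p j)) (Bin Less (eord p j) (R rB)).
Definition eshift p j := Bin Mul (R rb) (eord p j).

(** A register cannot be selected by a computed index, so every word is inspected and all terms but
    the one of the word that holds block [p] vanish. *)
Definition eget c f p :=
  foldr (fun j e => Bin Add
    (Bin Mul (ein p j) (elow (Bin Shr (RV f j) (eshift p j)) (R rb))) e)
    (Lit 0) (iota 0 c).

Definition einc o f p j :=
  Bin o (RV f j) (Bin Mul (ein p j) (Bin Shl (Lit 1) (eshift p j))).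

(** The formula of [blk_delete] if the deleted block lies in word [j] or before it, the unchanged
    word otherwise. A zero block moves into the last word. *)
Definition edel c f p j :=
  let cond := Bin Less (eord p j) (R rB) in
  Bin Add
    (Bin Mul cond
      (Bin Add
        (Bin Add (elow (RV f j) (eshift p j))
          (Bin Shl (Bin Shr (RV f j) (Bin Mul (R rb) (Bin Add (eord p j) (Lit 1))))
             (eshift p j)))
        (Bin Shl (elow (if j.+1 < c then RV f j.+1 else Lit 0) (R rb))
           (Bin Mul (R rb) (Bin Defs.Sub (R rB) (Lit 1))))))
    (Bin Mul (Bin Equal cond (Lit 0)) (RV f j)).

(** A sum modulo [2 ^ w] has overflowed iff it is smaller than a summand, and at most one of the two
    additions in a word overflows. The previous carry is repeated in the expression, whose size is
    exponential, but only in [c]. *)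
Fixpoint ecarry (x y : nat -> expr) (j : nat) : expr :=
  if j is i.+1 then
    Bin Add (Bin Less (Bin Add (x i) (y i)) (x i))
      (Bin Less (Bin Add (Bin Add (x i) (y i)) (ecarry x y i)) (ecarry x y i))
  else Lit 0.

Definition esum x y j := Bin Add (Bin Add (x j) (y j)) (ecarry x y j).

Definition enz c f := foldr (fun j e => Bin Or (RV f j) e) (Lit 0) (iota 0 c).

Lemma carry_bit V x y d : 1 < V -> x < V -> y < V -> d < 2 ->
  (((x + y) %% V < x) + (((x + y) %% V + d) %% V < d)) %% V = (x + y + d) %/ V.
Proof.
move=> V1 xV yV d2; case: (ltnP (x + y) V) => h.
  rewrite (modn_small h); have -> : (x + y < x) = false by apply/negbTE; lia.
  case: (ltnP (x + y + d) V) => h2.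
    rewrite (modn_small h2) (divn_small h2) (_ : (_ < d) = false) ?mod0n //.
    by apply/negbTE; lia.
  have d1 : d = 1 by lia.
  have -> : x + y + d = V by lia.
  by rewrite modnn divnn (ltnW V1) d1 modn_small.
have E1 : (x + y) %% V = x + y - V.
  by rewrite -{1}(subnK h) modnDr modn_small //; lia.
have -> : (x + y + d) %/ V = 1.
  have -> : x + y + d = 1 * V + (x + y - V + d) by lia.
  by rewrite divnMDl ?divn_small //; lia.
rewrite E1 (_ : x + y - V < x); last by lia.
rewrite (modn_small (m := x + y - V + d)); last by lia.
have -> : (x + y - V + d < d) = false by apply/negbTE; lia.
by rewrite modn_small.
Qed.

Lemma modn_mulr_split A Z V : 0 < Z -> 0 < V ->
  A %% (Z * V) = A %% Z + Z * (A %/ Z %% V).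
Proof.
move=> Z0 V0; rewrite {1}(divn_eq A Z) {1}(divn_eq (A %/ Z) V).
rewrite mulnDl -mulnA (mulnC V) -addnA modnMDl mulnC addnC modn_small //.
have := ltn_pmod (A %/ Z) V0; have := ltn_pmod A Z0.
move: (A %% Z) (A %/ Z %% V) => x y; clear; nia.
Qed.

Section Exprs.
Variables (w c : nat) (s : state).
Notation ev := (eval w s).
Local Notation W := (2 ^ w).

Lemma ev_sub e1 e2 : ev e2 <= ev e1 -> ev e1 < W ->
  ev (Bin Defs.Sub e1 e2) = ev e1 - ev e2.
Proof.
move=> le lt /=; have -> : ev e1 + (W - ev e2) = ev e1 - ev e2 + W by lia.
by rewrite modnDr modn_small //; lia.
Qed.

Lemma ev_sat e1 e2 : ev e1 < W -> ev (esat e1 e2) = ev e1 - ev e2.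
Proof.
move=> lt.
have -> : ev (esat e1 e2) = ((ev e2 < ev e1) * ev (Bin Defs.Sub e1 e2)) %% W by [].
case: ltnP => h.
  by rewrite ev_sub ?mul1n ?modn_small //; [lia|exact: ltnW].
by rewrite mul0n mod0n; lia.
Qed.

Lemma ev_low e1 e2 : ev e1 < W -> ev (elow e1 e2) = ev e1 %% 2 ^ ev e2.
Proof.
move=> lt; rewrite ev_sub //= modn_small; try by apply: leq_ltn_trans (leq_divM _ _) lt.
  by rewrite {1}(divn_eq (ev e1) (2 ^ ev e2)) addnC addnK.
exact: leq_divM.
Qed.

Lemma ev_nz f : (ev (enz c f) != 0) = (vec c (rg s f) != nseq c 0).
Proof.
rewrite /enz /vec -[in nseq _ _](size_iota 0 c).
elim: (iota 0 c) => [|j l IH] /=; first by rewrite mod0n.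
rewrite eqseq_cons negb_and -IH.
have E : (Nat.lor (regs s (enc f j)) (eval w s (foldr (fun j e => Bin Or (RV f j) e) (Lit 0) l)) == 0)
   = (rg s f j == 0) && (eval w s (foldr (fun j e => Bin Or (RV f j) e) (Lit 0) l) == 0).
  by apply/eqP/andP => [/PeanoNat.Nat.lor_eq_0_iff [/eqP ? /eqP ?]|[/eqP ? /eqP ?]] //; apply/PeanoNat.Nat.lor_eq_0_iff.
by rewrite E negb_and.
Qed.

Section Carry.
Variables (x y : nat -> expr) (M N : nat).
Hypotheses (hx : forall j, j < c -> ev (x j) = M %/ 2 ^ (w * j) %% W).
Hypotheses (hy : forall j, j < c -> ev (y j) = N %/ 2 ^ (w * j) %% W).

(** Splitting off word [j] from the lower ones reduces the step to [carry_bit]; the incoming carry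
    is a bit because both lower parts are below [2 ^ (w * j)]. *)
Lemma ev_carry j : 0 < w -> j <= c ->
  ev (ecarry x y j) = (M %% 2 ^ (w * j) + N %% 2 ^ (w * j)) %/ 2 ^ (w * j).
Proof.
move=> w0; elim: j => [|j IH] jc; first by rewrite muln0 !modn1 /= mod0n.
have cy := IH (ltnW jc).
have W1 : 1 < W by rewrite -{1}(expn0 2) ltn_exp2l.
have Z0 : 0 < 2 ^ (w * j) by rewrite expn_gt0.
have lm := ltn_pmod M Z0; have ln := ltn_pmod N Z0.
rewrite /= cy hx // hy // mulnS addnC expnD.
rewrite (mulnC W) !modn_mulr_split //; try exact: ltnW.
set a := _ %/ _ %% _; set a' := (N %/ _) %% _.
have la : a < W by rewrite ltn_pmod // ltnW.
have la' : a' < W by rewrite ltn_pmod // ltnW.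
set m0 := M %% _ in lm *; set n0 := N %% _ in ln *.
have -> : m0 + 2 ^ (w * j) * a + (n0 + 2 ^ (w * j) * a') =
   (a + a') * 2 ^ (w * j) + (m0 + n0) by rewrite addnACA -mulnDr addnC mulnC.
rewrite divnMA divnMDl //.
have : (m0 + n0) %/ 2 ^ (w * j) < 2 by rewrite ltn_divLR // mul2n -addnn; move: lm ln; clear; lia.
move: ((m0 + n0) %/ _) => d d2.
move: (2 ^ w) W1 la la' => Wv W1 la la'.
by rewrite [X in X %% _]addnC carry_bit.
Qed.

(** The carry out of the last word is dropped, in agreement with [digits]. *)
Lemma ev_sum j : 0 < w -> j < c -> ev (esum x y j) = (M + N) %/ 2 ^ (w * j) %% W.
Proof.
move=> w0 jc.
have -> : ev (esum x y j) = ((ev (x j) + ev (y j)) %% W + ev (ecarry x y j)) %% W by [].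
rewrite (ev_carry w0 (ltnW jc)) (hx jc) (hy jc).
set Z := 2 ^ (w * j); have Z0 : 0 < Z by rewrite expn_gt0.
rewrite modnDm modnDml; congr (_ %% _).
rewrite {3}(divn_eq M Z) {3}(divn_eq N Z).
by rewrite addnACA -mulnDl divnMDl.
Qed.
End Carry.

Section BlockExprs.
Variables (b B q : nat) (p : expr) (f : nat) (t : seq nat).
Hypotheses (b_gt0 : 0 < b) (B_gt0 : 0 < B) (bBw : b * B <= w).
Hypotheses (sb : rg s rb 0 = b) (sB : rg s rB 0 = B).
Hypotheses (pW : q.+1 < W) (evp : ev p = q.+1).
Hypotheses (sf : forall j, j < c -> rg s f j = blk b B t j).
Hypothesis fit_t : letters_fit b t.

Let W1 : 1 < W. Proof. exact: leq_ltn_trans pW. Qed.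
Let wW : w < W. Proof. exact: ltn_expl. Qed.
Let bw : b <= w. Proof. by apply: leq_trans bBw; apply: leq_pmulr. Qed.
Let BW : B < W.
Proof. by apply: leq_ltn_trans wW; apply: leq_trans bBw; apply: leq_pmull. Qed.
Let ev1 : ev (Lit 1) = 1. Proof. exact: modn_small. Qed.
Let ev0 : ev (Lit 0) = 0. Proof. exact: mod0n. Qed.
Let blkW u j : letters_fit b u -> blk b B u j < W.
Proof.
move=> h; apply: leq_trans (blk_lt _ _ h) _; exact: leq_pexp2l.
Qed.

Lemma ev_off j : ev (eoff p j) = q.+1 - j * B.
Proof.
elim: j => [|j IH]; first by rewrite mul0n subn0.
rewrite /eoff iterS -/(eoff p j) ev_sat IH; first by rewrite /= -/(rg s rB 0) sB; lia.
by apply: leq_ltn_trans pW; apply: leq_subr.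
Qed.

Lemma ev_ord j : ev (eord p j) = q - j * B.
Proof.
rewrite ev_sat ev_off ?ev1; first by lia.
by apply: leq_ltn_trans pW; apply: leq_subr.
Qed.

Lemma ev_in j : ev (ein p j) = (j * B <= q < j * B + B).
Proof.
have -> : ev (ein p j) =
   ((ev (Lit 0) < ev (eoff p j)) * (ev (eord p j) < rg s rB 0)) %% W by [].
rewrite ev0 ev_off ev_ord sB mulnb modn_small.
  congr nat_of_bool; move: B_gt0; clear; lia.
by apply: leq_ltn_trans W1; case: (_ && _).
Qed.

Lemma ev_shift j : q - j * B <= B -> ev (eshift p j) = b * (q - j * B).
Proof.
move=> h; have -> : ev (eshift p j) = (rg s rb 0 * ev (eord p j)) %% W by [].
rewrite sb ev_ord modn_small //; apply: leq_ltn_trans wW.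
by apply: leq_trans bBw; rewrite leq_mul2l h orbT.
Qed.

Lemma ev_get : q < c * B -> ev (eget c f p) = nth 0 t q.
Proof.
move=> qc; rewrite /eget; set F := fun j e => _.
suff gen n m : m + n <= c -> ev (foldr F (Lit 0) (iota m n)) =
    if m * B <= q < (m + n) * B then nth 0 t q else 0.
  by rewrite gen // add0n qc.
elim: n m => [|n IH] m mc.
  rewrite addn0 [LHS]/= mod0n; case: ifP => // /andP [h1 h2].
  by move: (leq_ltn_trans h1 h2); rewrite ltnn.
rewrite [iota _ _]/= [foldr _ _ _]/= {1}/F.
set g := foldr _ _ _; set e := Bin Mul _ _.
have -> : ev (Bin Add e g) = (ev e + ev g) %% W by [].
have mc' : m.+1 + n <= c by rewrite addSnnS.
rewrite /g IH // addSnnS; set h := elow _ _ in e *.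
have -> : ev e = (ev (ein p m) * ev h) %% W by [].
rewrite ev_in; case: (boolP (m * B <= q < m * B + B)) => inm.
  have qB : q - m * B < B by move: inm; clear; lia.
  have -> : (m.+1 * B <= q) = false by apply/negbTE; move: inm; clear; lia.
  have -> : m * B <= q < (m + n.+1) * B by move: inm; clear; nia.
  have mc2 : m < c by move: mc; clear; lia.
  have eS : ev (Bin Shr (RV f m) (eshift p m)) = blk b B t m %/ 2 ^ (b * (q - m * B)).
    by rewrite /= -/(rg s f m) sf // -(ev_shift (ltnW qB)).
  have lS : ev (Bin Shr (RV f m) (eshift p m)) < W.
    by rewrite eS; apply: leq_ltn_trans (leq_div _ _) (blkW _ fit_t).
  rewrite addn0 mul1n modn_mod /h ev_low // eS.
  have -> : ev (R rb) = b by exact: sb.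
  rewrite blk_get // subnKC; last by move: inm => /andP [].
  rewrite modn_small //; apply: leq_trans (letters_fit_nth _ fit_t) _.
  by rewrite leq_pexp2l.
rewrite mul0n mod0n add0n.
have -> : (m.+1 * B <= q < (m + n.+1) * B) = (m * B <= q < (m + n.+1) * B).
  by move: inm; clear; nia.
case: ifP => _; last by rewrite mod0n.
rewrite modn_small //; apply: leq_trans (letters_fit_nth _ fit_t) _.
by rewrite leq_pexp2l.
Qed.

Let ev_unit j : ev (Bin Mul (ein p j) (Bin Shl (Lit 1) (eshift p j))) =
  if j * B <= q < j * B + B then 2 ^ (b * (q - j * B)) else 0.
Proof.
have -> : ev (Bin Mul (ein p j) (Bin Shl (Lit 1) (eshift p j))) =
  (ev (ein p j) * ((ev (Lit 1) * 2 ^ ev (eshift p j)) %% W)) %% W by [].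
rewrite ev_in ev1 mul1n; case: ifP => inj; last by rewrite mul0n mod0n.
have qB : q - j * B < B by move: inj; clear; lia.
rewrite ev_shift ?(ltnW qB) // mul1n modn_mod modn_small // ltn_exp2l //.
by apply: leq_trans bBw; rewrite ltn_mul2l b_gt0.
Qed.

Variable t' : seq nat.
Hypothesis fit_t' : letters_fit b t'.

Lemma ev_inc_add j : rg s f j = blk b B t j ->
  (forall m, nth 0 t' m = nth 0 t m + (m == q)) ->
  ev (einc Add f p j) = blk b B t' j.
Proof.
move=> ef E; have -> : ev (einc Add f p j) =
  (rg s f j + ev (Bin Mul (ein p j) (Bin Shl (Lit 1) (eshift p j)))) %% W by [].
by rewrite ef ev_unit -(blk_add b B_gt0 j E) modn_small ?blkW.
Qed.

Lemma ev_inc_sub j : rg s f j = blk b B t j ->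
  (forall m, nth 0 t m = nth 0 t' m + (m == q)) ->
  ev (einc Defs.Sub f p j) = blk b B t' j.
Proof.
move=> hf E; have eb := blk_add b B_gt0 j E.
have ef : ev (RV f j) = blk b B t j by exact: hf.
rewrite /einc ev_sub ef ?ev_unit ?blkW //; first by rewrite eb addnK.
by rewrite eb leq_addl.
Qed.

Lemma ev_del j : j < c -> size t <= c * B ->
  (forall m, nth 0 t' m = nth 0 t (m + (q <= m))) ->
  ev (edel c f p j) = blk b B t' j.
Proof.
move=> jc szt E; rewrite /edel; set cond := Bin Less _ _.
set e := (X in Bin Mul cond X).
have -> : ev (Bin Add (Bin Mul cond e) (Bin Mul (Bin Equal cond (Lit 0)) (RV f j))) =
  ((ev cond * ev e) %% W + ((ev cond == ev (Lit 0)) * rg s f j) %% W) %% W by [].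
have -> : ev cond = (q - j * B < B).
  by rewrite /cond [LHS]/= -/(rg s rB 0) sB -ev_ord.
rewrite ev0 sf //; case: ltnP => qB; last first.
  rewrite mul0n mod0n add0n mul1n modn_mod modn_small ?blkW //.
  by rewrite (blk_before b B_gt0 _ E) //; move: qB B_gt0; clear; lia.
have qB' : q < j * B + B by move: qB; clear; lia.
rewrite (_ : (nat_of_bool true == 0) = false) // mul0n mod0n addn0 mul1n modn_mod.
have D := blk_delete B_gt0 fit_t qB' E; rewrite /= in D.
(* By [D], the summands and their partial sums are at most this number, so none of the operations
   that assemble them wraps around. *)
have tW : blk b B t' j < W by apply: blkW.
suff -> : ev e = blk b B t' j by rewrite modn_small.
rewrite /e; set e1 := elow _ _; set e2 := Bin Shl _ _; set e3 := Bin Shl _ _.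
have -> : ev (Bin Add (Bin Add e1 e2) e3) = ((ev e1 + ev e2) %% W + ev e3) %% W by [].
have sh := ev_shift (ltnW qB).
have ef : ev (RV f j) = blk b B t j by exact: sf.
have -> : ev e1 = blk b B t j %% 2 ^ (b * (q - j * B)) by rewrite ev_low ef ?sh ?blkW.
have -> : ev e2 = blk b B t j %/ 2 ^ (b * (q - j * B).+1) * 2 ^ (b * (q - j * B)).
  have -> : ev e2 = (ev (RV f j) %/ 2 ^ ((rg s rb 0 * ((ev (eord p j) + ev (Lit 1)) %% W)) %% W)
     * 2 ^ ev (eshift p j)) %% W by [].
  rewrite sh ef sb ev_ord ev1 addn1 (modn_small (m := (q - _).+1)); last first.
    exact: leq_ltn_trans BW.
  rewrite (modn_small (m := b * _)); last first.
    apply: leq_ltn_trans wW; apply: leq_trans bBw; by rewrite leq_mul2l qB orbT.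
  rewrite modn_small //; apply: leq_ltn_trans tW; rewrite D.
  by rewrite -addnA addnCA leq_addr.
have -> : ev e3 = blk b B t j.+1 %% 2 ^ b * 2 ^ (b * B.-1).
  set e4 := elow _ _ in e3 *.
  have -> : ev e3 = (ev e4 * 2 ^ ((rg s rb 0 * ev (Bin Defs.Sub (R rB) (Lit 1))) %% W)) %% W by [].
  have -> : ev (Bin Defs.Sub (R rB) (Lit 1)) = B.-1.
    have eB : ev (R rB) = B by exact: sB.
    by rewrite ev_sub ?ev1 ?eB // subn1.
  have e5 : ev (if j.+1 < c then RV f j.+1 else Lit 0) = blk b B t j.+1.
    case: ltnP => h; first exact: sf.
    rewrite ev0 /blk /poly big1 // => r _; rewrite nth_default //.
    apply: leq_trans szt _; move: h; clear; nia.
  have -> : ev e4 = blk b B t j.+1 %% 2 ^ b.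
    by rewrite ev_low e5 ?blkW //; congr (_ %% 2 ^ _); exact: sb.
  rewrite sb (modn_small (m := b * _)); last first.
    by apply: leq_ltn_trans wW; apply: leq_trans bBw; rewrite leq_mul2l leq_pred orbT.
  by rewrite modn_small //; apply: leq_ltn_trans tW; rewrite D leq_addl.
rewrite D in tW *; rewrite modnDml modn_small //.
Qed.
End BlockExprs.
End Exprs.
(** * The program *)

(** [rL] is the current length, [rt] a loop counter; [rF], [rprev] and [rp] are the flag of the
    order test and the previous and current position. [vT] and [vI] hold [tau] and its inverse, [vA]
    the word [tau] with its large letters decremented, [vE] the key of [tau] minus [v], [vacc] the
    count [P i tau], and [vlast] the permutation read last. *)
Local Notation rL := 2 (only parsing).
Local Notation rk := 3 (only parsing).
Local Notation rt := 4 (only parsing).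
Local Notation rF := 5 (only parsing).
Local Notation rprev := 6 (only parsing).
Local Notation rp := 7 (only parsing).
Local Notation rv := 8 (only parsing).
Local Notation vT := 10 (only parsing).
Local Notation vI := 11 (only parsing).
Local Notation vA := 12 (only parsing).
Local Notation vE := 13 (only parsing).
Local Notation vacc := 14 (only parsing).
Local Notation vsum := 15 (only parsing).
Local Notation vq := 16 (only parsing).
Local Notation vlast := 17 (only parsing).
(* Keyed by a packed permutation: its inverse [tI], its successor [tNB] among the
   permutations of its length, its successor [tNO] in the input order, and, with [i]
   appended, the counts [tP].  [tHB] maps a length to the head of its list; the
   all-zero vector ends the lists, and as a key of [tNO] it yields the first input. *)
Local Notation tI := 0 (only parsing).
Local Notation tNB := 1 (only parsing).
Local Notation tHB := 2 (only parsing).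
Local Notation tNO := 3 (only parsing).
Local Notation tPI := 4 (only parsing).
Local Notation tX := 5 (only parsing).
Local Notation tP := 6 (only parsing).
Local Notation "p ;; q" := (Seq p q) (at level 61, right associativity).
Local Notation "f <~ e" := (Assign (enc f 0) e) (at level 60).

(* Decides [P k tau], and decrements the [k] largest letters in [vA]. *)
Definition base_body c :=
  rt <~ Bin Add (R rt) (Lit 1) ;;
  Lookup (enc rv 0) (enc tPI 0) [:: R rt] ;;
  rp <~ eget c vI (Bin Add (Bin Defs.Sub (R rL) (R rk)) (R rv)) ;;
  vassign c vA (einc Defs.Sub vA (R rp)) ;;
  rF <~ Bin Mul (R rF) (Bin Less (R rprev) (R rp)) ;;
  rprev <~ R rp.

(* From [P (i + 1) tau] to [P i tau], where [rt] goes from [i + 1] to [i]. *)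
Definition delete_body c :=
  rt <~ Bin Defs.Sub (R rt) (Lit 1) ;;
  rp <~ eget c vI (Bin Defs.Sub (R rL) (R rt)) ;;
  vassign c vA (einc Add vA (R rp)) ;;
  vassign c vE (edel c vA (R rp)) ;;
  vlookup c vq tP (keys c vE ++ [:: R rt]) ;;
  Lookup (enc rv 0) (enc tX 0) [:: Bin Defs.Sub (R rk) (R rt)] ;;
  vassign c vsum
    (esum (RV vacc) (fun j => Bin Mul (RV vq j) (Bin Equal (R rv) (Lit 0)))) ;;
  vassign c vacc (RV vsum) ;;
  vinsert c tP (keys c vT ++ [:: R rt]) (RV vacc).

Definition process_init c :=
  vlookup c vI tI (keys c vT) ;;
  vassign c vA (RV vT) ;;
  (* Positions count from 1, so the first comparison with [rprev] always succeeds. *)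
  rF <~ Lit 1 ;; rprev <~ Lit 0 ;; rt <~ Lit 0.

(** Joins the constraint at 0, which for [P k tau] means that [tau] has length [k], to the order
    test; the resulting bit starts the accumulator. *)
Definition process_mid c :=
  Lookup (enc rv 0) (enc tX 0) [:: Lit 0] ;;
  rF <~ Bin Mul (R rF) (Bin Equal (Bin Mul (R rv) (Bin Less (R rk) (R rL))) (Lit 0)) ;;
  vassign c vacc (fun j => if j == 0 then R rF else Lit 0) ;;
  rt <~ R rk.

Definition process c :=
  process_init c ;;
  While (Bin Less (R rt) (R rk)) (base_body c) ;;
  process_mid c ;;
  While (R rt) (delete_body c).

(** The constants 3 and 1 are the costs of the two loop tests, 4 and 2 those of the final failing
    tests. Multiplied by [k.+1], the sum bounds [process]. *)
Definition process_time c :=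
  max_time (process_init c) + (3 + max_time (base_body c)).+1 + 4
  + max_time (process_mid c) + (1 + max_time (delete_body c)).+1 + 2.

(** The permutation becomes the head of the list of its length but is appended to the list in input
    order, after [vlast]. The last command fetches the next length, or the closing 0 that ends the
    loop. *)
Definition read_body c :=
  vread c vT ;; vread c vI ;;
  vinsert c tI (keys c vT) (RV vI) ;;
  vlookup c vq tHB [:: R rL] ;;
  vinsert c tNB (keys c vT) (RV vq) ;;
  vinsert c tHB [:: R rL] (RV vT) ;;
  vinsert c tNO (keys c vlast) (RV vT) ;;
  vassign c vlast (RV vT) ;;
  Read (enc rL 0).

Definition load_body t :=
  rt <~ Bin Add (R rt) (Lit 1) ;;
  Read (enc rv 0) ;;
  Insert (enc t 0) [:: R rt] (R rv).

(* The increment of [rL] may wrap around to 0, whose list is empty as well. *)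
Definition advance c :=
  vlookup c vq tNB (keys c vT) ;;
  vassign c vT (RV vq) ;;
  If (enz c vT) Skip
    (rL <~ Bin Add (R rL) (Lit 1) ;; vlookup c vT tHB [:: R rL]).

Definition main_body c :=
  If (Bin Less (R rL) (R rk)) Skip (process c) ;; advance c.

Definition output_body c :=
  vlookup c vq tP (keys c vT ++ [:: Lit 0]) ;;
  vwrite c (RV vq) ;;
  vlookup c vq tNO (keys c vT) ;;
  vassign c vT (RV vq).

Definition read_k := Read (enc rk 0) ;; rt <~ Lit 0.

(** [X] has [k + 1] entries, and [k + 1] need not fit into a word; with entry 0 loaded separately
    the counter stops at [k]. *)
Definition load_X0 :=
  rt <~ Lit 0 ;; Read (enc rv 0) ;; Insert (enc tX 0) [:: R rt] (R rv).

Definition first_bucket c := rL <~ Lit 1 ;; vlookup c vT tHB [:: R rL].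

Definition first_output c := vlookup c vT tNO (nseq c (Lit 0)).

Definition count_prog c :=
  read_k ;; While (Bin Less (R rt) (R rk)) (load_body tPI) ;;
  load_X0 ;; While (Bin Less (R rt) (R rk)) (load_body tX) ;;
  first_bucket c ;; While (enz c vT) (main_body c) ;;
  first_output c ;; While (enz c vT) (output_body c).

Definition init_prog :=
  Read (enc rv 0) ;; Read (enc rb 0) ;; rB <~ Bin Div (R rv) (R rb) ;;
  Read (enc rv 0) ;; Read (enc rL 0).

(** For empty [D] the allowed time is constant, so not even the pattern may be read; a zero [vlast]
    reveals this case. *)
Definition prog c :=
  init_prog ;; While (R rL) (read_body c) ;; If (enz c vlast) (count_prog c) Skip.

Definition count_time c k N :=
  max_time read_k + (k * (3 + max_time (load_body tPI)).+1 + 4 +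
  (max_time load_X0 + (k * (3 + max_time (load_body tX)).+1 + 4 +
  (max_time (first_bucket c) +
  (N * (cost (enz c vT) + ((3 + process_time c * k.+1).+1 + max_time (advance c))).+1
     + (cost (enz c vT)).+1 +
  (max_time (first_output c) +
  (N * (cost (enz c vT) + max_time (output_body c)).+1 + (cost (enz c vT)).+1))))))).

(** * Effect of single updates on vectors and on decremented words *)

Lemma vec_upd c s s' f v :
  (forall g i, rg s' g i = if (g == f) && (i < c) then v i else rg s g i) ->
  forall g, vec c (rg s' g) = if g == f then vec c v else vec c (rg s g).
Proof.
move=> E g; case: eqP => [->|/eqP/negbTE ne]; apply: eq_vec => j jc; rewrite E.
  by rewrite eqxx jc.
by rewrite ne.
Qed.

Lemma vec_upd1 c s s' f x :
  (forall g i, rg s' g i = if (g == f) && (i == 0) then x else rg s g i) ->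
  forall g, g != f -> vec c (rg s' g) = vec c (rg s g).
Proof. by move=> E g /negbTE ne; apply: eq_vec => j jc; rewrite E ne. Qed.

Lemma vec_inj c f g j : vec c f = vec c g -> j < c -> f j = g j.
Proof. by move=> E jc; rewrite -(nth_vec f jc) E nth_vec. Qed.

Lemma nth_map_dec (f : nat -> nat) tau m : f 0 = 0 ->
  nth 0 (map f tau) m = f (nth 0 tau m).
Proof.
move=> f0; case: (ltnP m (size tau)) => h; first by rewrite (nth_map 0).
by rewrite !nth_default ?size_map.
Qed.

(** One more decremented letter changes one block by exactly 1: letters are positive, so truncated
    subtraction loses nothing. *)
Lemma nth_dec_step (S S' : pred nat) tau v i :
  uniq tau -> v \in tau -> 0 \notin tau -> ~~ S v ->
  (forall x, S' x = S x || (x == v)) ->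
  nth 0 [seq x - S x | x <- tau] i =
  nth 0 [seq x - S' x | x <- tau] i + (i == index v tau).
Proof.
move=> ut vt t0 vS E; rewrite !nth_map_dec //.
case: (ltnP i (size tau)) => iL; last first.
  rewrite nth_default // !sub0n gtn_eqF //.
  by apply: leq_trans iL; rewrite index_mem.
have -> : (i == index v tau) = (nth 0 tau i == v).
  apply/eqP/eqP => [->|<-]; first by rewrite nth_index.
  by rewrite index_uniq.
rewrite E; case: eqP => [->|_]; last by rewrite orbF addn0.
rewrite (negbTE vS) /= subn0 subn1 addn1 prednK // lt0n.
by apply: contraNneq t0 => <-.
Qed.

Lemma nth_rem v s m : nth 0 (rem v s) m = nth 0 s (m + (index v s <= m)).
Proof.
elim: s m => [|x s IH] m /=; first by rewrite !nth_nil.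
by case: eqP => _; [rewrite addn1|case: m => //= m; rewrite IH].
Qed.

Lemma nth_del v tau m :
  nth 0 (del v tau) m = nth 0 [seq x - (v < x) | x <- tau] (m + (index v tau <= m)).
Proof. by rewrite !nth_map_dec // nth_rem. Qed.

(** * Correctness of the program: inputs, keys and tables *)

Section Algorithm.
Variables (w b n k c : nat) (pi : seq nat) (X : {set 'I_k.+1}) (D : seq (seq nat)).
Let B := w %/ b.
Let W := 2 ^ w.
Let pkd := pk b B c.
Hypotheses (bw : b <= w) (nb : n < 2 ^ b) (ncB : n <= c * B).
Hypotheses (b_gt0 : 0 < b) (k_gt0 : 0 < k) (kW : k < 2 ^ w) (pi_perm : is_perm k pi).
Hypotheses (D_uniq : uniq D) (D_perm : all (in_Sle n) D) (D_down : downset D).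

Definition vtb (T : nat -> seq nat -> nat) t K := vec c (fun j => T (enc t j) K).

Lemma B_gt0 : 0 < B. Proof. by rewrite divn_gt0. Qed.
Lemma bB_le : b * B <= w. Proof. by rewrite mulnC; apply: leq_divM. Qed.
Lemma nW : n < W. Proof. by apply: leq_trans nb _; rewrite leq_pexp2l. Qed.
Lemma w_gt0 : 0 < w. Proof. exact: leq_trans bw. Qed.
Lemma W_gt1 : 1 < W. Proof. by rewrite -{1}(expn0 2) ltn_exp2l // w_gt0. Qed.

Lemma D_facts d : d \in D ->
  [/\ is_perm (size d) d, 0 < size d, size d <= n & size d <= c * B].
Proof.
move=> /(allP D_perm) /and3P [h1 h2 h3]; split=> //; exact: leq_trans ncB.
Qed.

Lemma fit_le s : {in s, forall x, x <= n} -> letters_fit b s.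
Proof. by move=> h; apply/allP => x /h xn; apply: leq_ltn_trans nb. Qed.

Lemma D_letter d x : d \in D -> x \in d -> 0 < x <= n.
Proof.
move=> /D_facts [dp _ dn _]; rewrite (mem_perm _ dp) => /andP [-> h].
exact: leq_trans dn.
Qed.

Lemma fit_D d : d \in D -> letters_fit b d.
Proof. by move=> dD; apply: fit_le => x /(D_letter dD) /andP []. Qed.

Lemma fit_inv d : d \in D -> letters_fit b (perm_inv d).
Proof.
move=> dD; have [dp _ dn _] := D_facts dD.
apply: fit_le => x /mapP [v]; rewrite mem_iota => hv ->.
apply: leq_trans dn; rewrite index_mem (mem_perm _ dp).
by case/andP: hv => -> /=; rewrite add1n ltnS.
Qed.

Lemma fit_dec d (f : nat -> bool) : d \in D -> letters_fit b [seq x - f x | x <- d].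
Proof.
move=> dD; apply: fit_le => _ /mapP [x /(D_letter dD) /andP [_ h] ->].
exact: leq_trans (leq_subr _ _) h.
Qed.

(** The empty word is included since it occurs as [del v tau] and its key is the null pointer. *)
Lemma pkd_inj : {in [::] :: D &, injective pkd}.
Proof.
have F d : d \in [::] :: D -> [/\ letters_fit b d, 0 \notin d & size d <= c * B].
  rewrite inE => /orP [/eqP -> //|dD]; split; first exact: fit_D.
    by apply/negP => /(D_letter dD).
  by case: (D_facts dD).
move=> d d' /F [h1 h2 h3] /F [h4 h5 h6]; apply: (pk_inj B_gt0) => //.
Qed.

Lemma del_D tau v : tau \in D -> v \in tau -> del v tau \in [::] :: D.
Proof.
move=> tD vt; have [tp _ _ _] := D_facts tD.
rewrite inE; case: eqP => //= ne; rewrite -std_rem //.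
apply: D_down tD _ _; first exact: rem_subseq.
by apply: contra_notN ne => /eqP E; rewrite /del E.
Qed.

Record tables (T : nat -> seq nat -> nat) : Prop := Tables {
  tables_inv : forall d, d \in D -> vtb T tI (pkd d) = pkd (perm_inv d);
  tables_pi : forall t, t < k -> T (enc tPI 0) [:: t.+1] = nth 0 pi t;
  tables_X : forall x : 'I_k.+1, T (enc tX 0) [:: nat_of_ord x] = (x \in X) }.

Lemma tables_ext T T' : (forall u i K, u != tP -> T' (enc u i) K = T (enc u i) K) ->
  tables T -> tables T'.
Proof.
move=> E [h1 h2 h3]; split=> *; rewrite ?E ?h2 ?h3 // -h1 //.
by apply: eq_vec => j _; rewrite E.
Qed.

Let th := top_hits pi X.

(** * Processing one permutation *)

Section Process.
Variable tau : seq nat.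
Hypotheses (tD : tau \in D) (kL : k <= size tau).
Let L := size tau.

Record ctx ip op (s : state) : Prop := Ctx {
  ctx_b : rg s rb 0 = b;
  ctx_B : rg s rB 0 = B;
  ctx_L : rg s rL 0 = L;
  ctx_k : rg s rk 0 = k;
  ctx_T : vec c (rg s vT) = pkd tau;
  ctx_in : inp s = ip;
  ctx_out : out s = op }.

Lemma ctx_ext ip op s s' : ctx ip op s ->
  (forall g, g \in [:: rb; rB; rL; rk] -> rg s' g 0 = rg s g 0) ->
  vec c (rg s' vT) = vec c (rg s vT) -> inp s' = inp s -> out s' = out s ->
  ctx ip op s'.
Proof. by move=> [h1 h2 h3 h4 h5 h6 h7] E E' Ei Eo; split; rewrite ?E ?E' ?Ei ?Eo. Qed.

Lemma sz_tau : L <= n /\ L <= c * B.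
Proof. by have [] := D_facts tD. Qed.

Lemma tau_pos : 0 \notin tau.
Proof. by apply/negP => /(D_letter tD). Qed.

Let ps := [seq (index (L - k + y) tau).+1 | y <- pi].
Let dec (S : pred nat) := [seq x - S x | x <- tau].

Lemma letter_pos y : y < L -> L - y \in tau /\ nth 0 (perm_inv tau) (L - y).-1 = (index (L - y) tau).+1.
Proof.
move=> yL; have [tp _ _ _] := D_facts tD.
have h : 0 < L - y <= L by lia.
by rewrite (mem_perm _ tp) nth_perm_inv.
Qed.

(** [path ltn 0] is the form in which the flag accumulates; as the positions in [ps] are positive,
    it says that those seen so far increase. *)
Record base_inv ip op T (m : nat) (s : state) : Prop := BaseInv {
  bi_ctx : ctx ip op s;
  bi_tabs : tabs s = T;
  bi_I : vec c (rg s vI) = pkd (perm_inv tau);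
  bi_m : m <= k;
  bi_t : rg s rt 0 = k - m;
  bi_F : rg s rF 0 = path ltn 0 (take (k - m) ps);
  bi_prev : rg s rprev 0 = last 0 (take (k - m) ps);
  bi_A : vec c (rg s vA) = pkd (dec (fun x => x \in [seq L - k + y | y <- take (k - m) pi])) }.

Lemma straight_base : straight (base_body c).
Proof. by rewrite /= straight_vseq. Qed.
Lemma straight_delete : straight (delete_body c).
Proof. by rewrite /= /vassign /vlookup /vinsert !straight_vseq. Qed.

Lemma size_pi_k : size pi = k. Proof. exact: size_pi pi_perm. Qed.

Lemma ev_lit1 s : eval w s (Lit 1) = 1. Proof. exact: modn_small W_gt1. Qed.
Lemma ev_lit0 s : eval w s (Lit 0) = 0. Proof. exact: mod0n. Qed.

Lemma base_step ip op T m s : tables T ->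
  base_inv ip op T m.+1 s ->
  runs w (base_body c) (max_time (base_body c)) s (base_inv ip op T m).
Proof.
move=> HT [cx tb_ hI mk ht hF hprev hA]; apply: runs_straight; first exact: straight_base.
have [Ln LcB] := sz_tau; have [tp _ _ _] := D_facts tD.
have LW : L < W by apply: leq_ltn_trans Ln nW.
have km : (k - m.+1).+1 = k - m by move: mk; clear; lia.
set t0 := k - m.+1 in ht hF hprev hA km.
have t0k : t0 < k by rewrite /t0; move: mk; clear; lia.
set y := nth 0 pi t0; set v := L - k + y.
have ypi : y \in pi by rewrite mem_nth // size_pi_k.
have yk : 0 < y <= k by rewrite -(mem_perm _ pi_perm).
have [vL v0] : v <= L /\ 0 < v by rewrite /v; move: yk kL; rewrite -/L; clear; lia.
have vE : v = L - (L - v) by rewrite subKn.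
have [vt pos] := @letter_pos (L - v) ltac:(move: v0 vL; clear; lia).
rewrite -vE in vt pos.
set q := index v tau; have qL : q < L by rewrite index_mem.
apply: wp_seq; apply: wp_assign => s1 E1 T1 I1 O1.
apply: wp_seq; apply: wp_lookup => s2 E2 T2 I2 O2.
apply: wp_seq; apply: wp_assign => s3 E3 T3 I3 O3.
have e1 : rg s1 rt 0 = k - m.
  rewrite E1 /= -/(eval w s (Lit 1)) ev_lit1 -/(rg s rt 0) ht addn1 km modn_small //.
  by apply: leq_ltn_trans kW; apply: leq_subr.
have e2 : rg s2 rv 0 = y.
  by rewrite E2 /= -/(rg s1 rt 0) e1 T1 tb_ -km (tables_pi HT t0k).
have ep : eval w s2 (Bin Add (Bin Defs.Sub (R rL) (R rk)) (R rv)) = v.-1.+1.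
  have l2 : eval w s2 (R rL) = L by rewrite -(ctx_L cx) -[LHS]/(rg s2 rL 0) E2 /= E1.
  have k2 : eval w s2 (R rk) = k by rewrite -(ctx_k cx) -[LHS]/(rg s2 rk 0) E2 /= E1.
  have -> : eval w s2 (Bin Add (Bin Defs.Sub (R rL) (R rk)) (R rv)) =
    (eval w s2 (Bin Defs.Sub (R rL) (R rk)) + rg s2 rv 0) %% W by [].
  by rewrite ev_sub ?l2 ?k2 // e2 -/v modn_small ?prednK //; apply: leq_ltn_trans LW.
have e3 : rg s3 rp 0 = q.+1.
  rewrite E3 [LHS]/= (@ev_get w c s2 b B v.-1 _ vI (perm_inv tau)) //.
  - exact: B_gt0.
  - exact: bB_le.
  - by rewrite E2 /= E1 /= (ctx_b cx).
  - by rewrite E2 /= E1 /= (ctx_B cx).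
  - by rewrite prednK //; apply: leq_ltn_trans LW.
  - by move=> j jc; rewrite E2 /= E1 /=; apply: (vec_inj hI).
  - exact: fit_inv.
  - by apply: leq_trans LcB; rewrite prednK.
pose S t := fun x => x \in [seq L - k + y | y <- take t pi].
have Sstep x : S (k - m) x = S t0 x || (x == v).
  rewrite /S -km (take_nth 0) ?size_pi_k // map_rcons mem_rcons inE orbC.
  by rewrite -/y -/v.
(* The letters of [pi] are distinct, so [v] has not been decremented before. *)
have vS : ~~ S t0 v.
  apply/mapP => - [z zt] /eqP; rewrite eqn_add2l => /eqP e.
  have := is_perm_uniq pi_perm; rewrite -(cat_take_drop t0 pi) cat_uniq => /and3P [_ /hasPn H _].
  have yd : y \in drop t0 pi by rewrite (drop_nth 0) ?size_pi_k // mem_head.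
  by have /negP := H _ yd; rewrite e; apply.
apply: wp_seq; apply: (wp_vassign (v := blk b B (dec (S (k - m))))) => [j s' jc h|s4 E4 T4 I4 O4].
  apply: (@ev_inc_sub w s' b B q _ vA (dec (S t0))) => //.
  - exact: B_gt0.
  - exact: bB_le.
  - by rewrite h // E3 /= E2 /= E1 /= (ctx_b cx).
  - by rewrite h // E3 /= E2 /= E1 /= (ctx_B cx).
  - by apply: leq_ltn_trans LW.
  - by rewrite -[LHS]/(rg s' rp 0) h.
  - exact: fit_dec.
  - by rewrite h ?leqnn ?orbT // E3 /= E2 /= E1 /=; apply: (vec_inj hA).
  - by move=> i; apply: nth_dec_step => //; [exact: is_perm_uniq tp|exact: tau_pos].
apply: wp_seq; apply: wp_assign => s5 E5 T5 I5 O5; apply: wp_assign => s6 E6 T6 I6 O6.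
have e1' : rg s5 rp 0 = q.+1 by rewrite E5 /= E4 /= e3.
have psE : take (k - m) ps = rcons (take t0 ps) q.+1.
  rewrite -km (take_nth 0) ?size_map ?size_pi_k //; congr rcons.
  by rewrite (nth_map 0) ?size_pi_k.
split.
- apply: (ctx_ext cx) => [g| | |]; rewrite ?I6 ?I5 ?I4 ?I3 ?I2 ?I1 ?O6 ?O5 ?O4 ?O3 ?O2 ?O1 //.
    rewrite !inE => /or4P [] /eqP ->; by rewrite E6 /= E5 /= E4 /= E3 /= E2 /= E1.
  by apply: eq_vec => j _; rewrite E6 /= E5 /= E4 /= E3 /= E2 /= E1.
- by rewrite T6 T5 T4 T3 T2 T1.
- by rewrite -hI; apply: eq_vec => j _; rewrite E6 /= E5 /= E4 /= E3 /= E2 /= E1.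
- exact: ltnW.
- by rewrite E6 /= E5 /= E4 /= E3 /= E2.
- rewrite E6 /= E5 [LHS]/= -/(rg s4 rF 0) -/(rg s4 rprev 0) -/(rg s4 rp 0) !E4 /=.
  rewrite e3 psE rcons_path E3 /= E2 /= E1 /= hF E3 /= E2 /= E1 /= hprev mulnb modn_small //.
  by apply: leq_ltn_trans W_gt1; case: (_ && _).
- by rewrite E6 [LHS]/= -/(rg s5 rp 0) e1' psE last_rcons.
- rewrite (vec_upd1 c E6) // (vec_upd1 c E5) // (vec_upd E4).
  by [].
Qed.

(** [m] is both the number of iterations left and the index of the count in [vacc]. [P k tau] is
    never stored, since the recurrence consults shorter words only at indices below [k]. *)
Record delete_inv ip op T (m : nat) (s : state) : Prop := DeleteInv {
  di_ctx : ctx ip op s;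
  di_I : vec c (rg s vI) = pkd (perm_inv tau);
  di_m : m <= k;
  di_t : rg s rt 0 = m;
  di_A : vec c (rg s vA) = pkd (dec (fun x => L - m < x));
  di_acc : vec c (rg s vacc) = digits w c (th m tau);
  di_other : forall u i K,
    (u != tP) || (K \notin [seq pkd tau ++ [:: i] | i <- iota 0 k]) ->
    tabs s (enc u i) K = T (enc u i) K;
  di_done : forall i, m <= i < k ->
    vtb (tabs s) tP (pkd tau ++ [:: i]) = digits w c (th i tau) }.

Lemma size_pkd d : size (pkd d) = c. Proof. by rewrite size_map size_iota. Qed.

Lemma key_inj d d' i i' : pkd d ++ [:: i] = pkd d' ++ [:: i'] -> pkd d = pkd d' /\ i = i'.
Proof.
move/eqP; rewrite eqseq_cat ?size_pkd // => /andP [/eqP -> /eqP [->]].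
by [].
Qed.

Lemma delete_step ip op T m s : tables T ->
  (forall sg, sg \in [::] :: D -> size sg = L.-1 -> forall i, i < k ->
    vtb T tP (pkd sg ++ [:: i]) = digits w c (th i sg)) ->
  delete_inv ip op T m.+1 s ->
  eval w s (R rt) != 0 /\
  runs w (delete_body c) (max_time (delete_body c)) s (delete_inv ip op T m).
Proof.
move=> HT HP [cx hI mk ht hA hacc hother hdone].
split; first by rewrite -[eval _ _ _]/(rg s rt 0) ht.
apply: runs_straight; first exact: straight_delete.
have [Ln LcB] := sz_tau; have [tp _ _ _] := D_facts tD.
have LW : L < W by apply: leq_ltn_trans Ln nW.
have mL : m < L by apply: leq_trans kL.
set v := L - m.
have [vt pos] := letter_pos mL; rewrite -/v in vt pos.
have v0 : 0 < v by rewrite subn_gt0.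
have vL : v <= L by apply: leq_subr.
set q := index v tau; have qL : q < L by rewrite index_mem.
apply: wp_seq; apply: wp_assign => s1 E1 T1 I1 O1.
apply: wp_seq; apply: wp_assign => s2 E2 T2 I2 O2.
have e1 : rg s1 rt 0 = m.
  have mW : m.+1 < W by apply: leq_ltn_trans kW.
  have ht' : eval w s (R rt) = m.+1 by exact: ht.
  by rewrite E1 !eqxx andTb ev_sub ?ev_lit1 ?ht' // subn1.
have ep : eval w s1 (Bin Defs.Sub (R rL) (R rt)) = v.-1.+1.
  have l2 : eval w s1 (R rL) = L by rewrite -(ctx_L cx) -[LHS]/(rg s1 rL 0) E1.
  have k2 : eval w s1 (R rt) = m by exact: e1.
  by rewrite ev_sub ?l2 ?k2 ?(ltnW mL) // prednK.
have e2 : rg s2 rp 0 = q.+1.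
  rewrite E2 [LHS]/= (@ev_get w c s1 b B v.-1 _ vI (perm_inv tau)) //.
  - exact: B_gt0.
  - exact: bB_le.
  - by rewrite E1 /= (ctx_b cx).
  - by rewrite E1 /= (ctx_B cx).
  - by rewrite prednK //; apply: leq_ltn_trans LW.
  - by move=> j jc; rewrite E1 /=; apply: (vec_inj hI).
  - exact: fit_inv.
  - by apply: leq_trans LcB; rewrite prednK.
pose A := dec (fun x => v < x).
apply: wp_seq; apply: (wp_vassign (v := blk b B A)) => [j s' jc h|s3 E3 T3 I3 O3].
  apply: (@ev_inc_add w s' b B q _ vA (dec (fun x => L - m.+1 < x))) => //.
  - exact: B_gt0.
  - exact: bB_le.
  - by rewrite h // E2 /= E1 /= (ctx_b cx).
  - by rewrite h // E2 /= E1 /= (ctx_B cx).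
  - by apply: leq_ltn_trans LW.
  - by rewrite -[LHS]/(rg s' rp 0) h.
  - exact: fit_dec.
  - exact: fit_dec.
  - by rewrite h ?leqnn ?orbT // E2 /= E1 /=; apply: (vec_inj hA).
  - move=> i; apply: (@nth_dec_step (fun x => v < x) (fun x => L - m.+1 < x)) => //.
    + exact: is_perm_uniq tp.
    + exact: tau_pos.
    + by rewrite ltnn.
    + by move=> x; rewrite /v; move: mL; clear; lia.
apply: wp_seq; apply: (wp_vassign (v := blk b B (del v tau))) => [j s' jc h|s4 E4 T4 I4 O4].
  apply: (@ev_del w c s' b B q _ vA A) => //.
  - exact: B_gt0.
  - exact: bB_le.
  - by rewrite h // E3 /= E2 /= E1 /= (ctx_b cx).
  - by rewrite h // E3 /= E2 /= E1 /= (ctx_B cx).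
  - by apply: leq_ltn_trans LW.
  - by rewrite -[LHS]/(rg s' rp 0) h // E3.
  - by move=> i ic; rewrite h // E3 /= ic.
  - exact: fit_dec.
  - have := del_D tD vt; rewrite inE => /orP [/eqP ->|] //; exact: fit_D.
  - by rewrite size_map.
  - by move=> i; rewrite nth_del.
have e4 : rg s4 rt 0 = m by rewrite E4 /= E3 /= E2 /= e1.
have T4' : tabs s4 = tabs s by rewrite T4 T3 T2 T1.
apply: wp_seq; apply: (wp_vlookup (K := pkd (del v tau) ++ [:: m])) => [s' h|s5 E5 T5 I5 O5].
  rewrite map_cat eval_keys; congr (_ ++ [:: _]); last by rewrite -[LHS]/(rg s' rt 0) h.
  by apply: eq_vec => j jc; rewrite h // E4 /= jc.
have e5 : vec c (rg s5 vq) = digits w c (th m (del v tau)).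
  rewrite (vec_upd E5) /= -HP //; first last.
  - by rewrite size_del.
  - exact: del_D.
  (* The loop has written only entries keyed by [tau]; the key looked up belongs to a shorter word,
     so its entry is still that of the initial table. *)
  apply: eq_vec => j _; rewrite T4' hother //; apply/orP; right.
  apply/mapP => - [i _] /key_inj [/pkd_inj E _].
  have tD' : tau \in [::] :: D by rewrite inE tD orbT.
  have := congr1 size (E (del_D tD vt) tD').
  by rewrite size_del //; rewrite -/L; move: mL; clear; lia.
apply: wp_seq; apply: wp_lookup => s6 E6 T6 I6 O6.
have km : k - m < k.+1 by rewrite ltnS leq_subr.
have e6 : rg s6 rv 0 = (inord (k - m) \in X).
  rewrite E6 [LHS]/= -(tables_X HT) inordK // T5 T4' hother //.
  congr (T _ [:: _]).
  have k2 : eval w s5 (R rk) = k.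
    by rewrite -(ctx_k cx) -[LHS]/(rg s5 rk 0) E5 /= E4 /= E3 /= E2 /= E1.
  have t2 : eval w s5 (R rt) = m by rewrite -[LHS]/(rg s5 rt 0) E5 /= e4.
  rewrite -[LHS]/(eval w s5 (Bin Defs.Sub (R rk) (R rt))).
  by rewrite ev_sub ?k2 ?t2 // ltnW.
have rec := top_hits_rec X k_gt0 pi_perm tp mk kL.
apply: wp_seq; apply: (wp_vassign (v := fun j => th m tau %/ 2 ^ (w * j) %% W)) =>
    [j s' jc h|s7 E7 T7 I7 O7].
  rewrite /th rec (ev_sum (c := c) (M := th m.+1 tau)
    (N := if inord (k - m) \in X then 0 else th m (del v tau))) //.
  - move=> i ic; rewrite -[LHS]/(rg s' vacc i) h // E6 /= E5 /= E4 /= E3 /= E2 /= E1 /=.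
    exact: (vec_inj hacc).
  - move=> i ic; have -> : eval w s' (Bin Mul (RV vq i) (Bin Equal (R rv) (Lit 0))) =
      (rg s' vq i * (rg s' rv 0 == eval w s' (Lit 0))) %% W by [].
    rewrite ev_lit0 !h // e6; case: (inord _ \in X); rewrite /= ?muln0 ?div0n //.
    rewrite muln1 E6 /= (vec_inj e5 ic) modn_mod //.
  - exact: w_gt0.
apply: wp_seq; apply: (wp_vassign (v := rg s7 vsum)) => [j s' jc h|s8 E8 T8 I8 O8].
  by rewrite -[LHS]/(rg s' vsum j) h.
apply: wp_vinsert => s9 E9 T9 I9 O9.
have accE : vec c (rg s8 vacc) = digits w c (th m tau).
  by rewrite (vec_upd E8) /= (vec_upd E7).
have KE : [seq eval w s8 i | i <- keys c vT ++ [:: R rt]] = pkd tau ++ [:: m].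
  rewrite map_cat eval_keys; congr (_ ++ [:: _]); last first.
    by rewrite -[LHS]/(rg s8 rt 0) E8 /= E7 /= E6 /= E5 /= e4.
  rewrite -(ctx_T cx); apply: eq_vec => j _.
  by rewrite E8 /= E7 /= E6 /= E5 /= E4 /= E3 /= E2 /= E1.
have T8' : tabs s8 = tabs s by rewrite T8 T7 T6 T5 T4'.
split.
- apply: (ctx_ext cx) => [g| | |].
  + rewrite !inE => /or4P [] /eqP ->;
    by rewrite E9 E8 /= E7 /= E6 /= E5 /= E4 /= E3 /= E2 /= E1.
  + by apply: eq_vec => j _; rewrite E9 E8 /= E7 /= E6 /= E5 /= E4 /= E3 /= E2 /= E1.
  + by rewrite I9 I8 I7 I6 I5 I4 I3 I2 I1.
  + by rewrite O9 O8 O7 O6 O5 O4 O3 O2 O1.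
- rewrite -hI; apply: eq_vec => j _.
  by rewrite E9 E8 /= E7 /= E6 /= E5 /= E4 /= E3 /= E2 /= E1.
- exact: ltnW.
- by rewrite E9 E8 /= E7 /= E6 /= E5 /= e4.
- apply: eq_vec => j jc; rewrite E9 E8 /= E7 /= E6 /= E5 /= E4 /= E3 /= jc.
  by [].
- by rewrite -accE; apply: eq_vec => j jc; rewrite E9.
- move=> u i K h; rewrite T9 KE T8'; case: and3P => [[/eqP hu hi /eqP hK]|_].
    move: h; rewrite hu eqxx hK /= => /negP []; apply/mapP; exists m => //.
    by rewrite mem_iota.
  exact: hother.
- move=> i /andP [mi ik].
  rewrite /vtb; case: (eqVneq i m) => [->|ne].
    by rewrite -accE; apply: eq_vec => j jc; rewrite T9 KE jc !eqxx.
  rewrite -hdone; last by rewrite ik andbT ltn_neqAle eq_sym ne.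
  apply: eq_vec => j jc; rewrite T9 KE T8'; case: and3P => // - [_ _ /eqP /key_inj [_ /eqP]].
  by rewrite (negbTE ne).
Qed.

Lemma process_spec ip op s : ctx ip op s -> tables (tabs s) ->
  (forall sg, sg \in [::] :: D -> size sg = L.-1 -> forall i, i < k ->
    vtb (tabs s) tP (pkd sg ++ [:: i]) = digits w c (th i sg)) ->
  runs w (process c) (process_time c * k.+1) s (delete_inv ip op (tabs s) 0).
Proof.
move=> cx HT HP; have [tp _ _ _] := D_facts tD.
set T := tabs s in HT HP *.
have tm t1 u1 v1 t2 u2 v2 :
  t1 + (k * u1 + v1 + (t2 + (k * u2 + v2))) <= (t1 + u1 + v1 + t2 + u2 + v2) * k.+1.
  by clear; nia.
apply: runs_weaken (tm _ _ _ _ _ _) (fun _ h => h).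
apply: runs_seq; apply: (@runs_weaken _ _ (max_time (process_init c)) _ _ (base_inv ip op T k)) => //.
  apply: runs_straight; first by rewrite /= /vlookup /vassign !straight_vseq.
  apply: wp_seq; apply: (wp_vlookup (K := pkd tau)) => [s' h|s1 E1 T1 I1 O1].
    by rewrite eval_keys -(ctx_T cx); apply: eq_vec => j _; rewrite h.
  apply: wp_seq; apply: (wp_vassign (v := rg s vT)) => [j s' jc h|s2 E2 T2 I2 O2].
    by rewrite -[LHS]/(rg s' vT j) h // E1.
  apply: wp_seq; apply: wp_assign => s3 E3 T3 I3 O3.
  apply: wp_seq; apply: wp_assign => s4 E4 T4 I4 O4.
  apply: wp_assign => s5 E5 T5 I5 O5.
  split.
  - apply: (ctx_ext cx) => [g| | |].
    + by rewrite !inE => /or4P [] /eqP ->; rewrite E5 /= E4 /= E3 /= E2 /= E1.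
    + by apply: eq_vec => j _; rewrite E5 /= E4 /= E3 /= E2 /= E1.
    + by rewrite I5 I4 I3 I2 I1.
    + by rewrite O5 O4 O3 O2 O1.
  - by rewrite T5 T4 T3 T2 T1.
  - rewrite -(tables_inv HT) //; apply: eq_vec => j jc.
    by rewrite E5 /= E4 /= E3 /= E2 /= E1 /= jc.
  - by [].
  - by rewrite E5 /= mod0n subnn.
  - by rewrite E5 /= E4 /= E3 /= subnn take0 /= modn_small // W_gt1.
  - by rewrite E5 /= E4 /= mod0n subnn take0.
  - rewrite subnn take0 /dec map_id_in => [|x _]; last by rewrite in_nil subn0.
    rewrite -(ctx_T cx); apply: eq_vec => j jc.
    by rewrite E5 /= E4 /= E3 /= E2 /= jc.
move=> s1 B1; apply: runs_seq.
apply: (@runs_weaken _ _ (k * (3 + max_time (base_body c)).+1 + 4) _ _ (base_inv ip op T 0)) => //.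
  apply: (runs_while (I := base_inv ip op T)) B1 => [m s2 B2|s2 B2].
    split; last exact: base_step.
    have -> : eval w s2 (Bin Less (R rt) (R rk)) = (rg s2 rt 0 < rg s2 rk 0) by [].
    rewrite (bi_t B2) (ctx_k (bi_ctx B2)); have := bi_m B2; clear; lia.
  have -> : eval w s2 (Bin Less (R rt) (R rk)) = (rg s2 rt 0 < rg s2 rk 0) by [].
  by rewrite (bi_t B2) (ctx_k (bi_ctx B2)) subn0 ltnn.
move=> s2 [cx2 T2 hI2 _ ht hF hprev hA]; rewrite subn0 in ht hF hprev hA; apply: runs_seq.
apply: (@runs_weaken _ _ (max_time (process_mid c)) _ _ (delete_inv ip op T k)) => //.
  apply: runs_straight; first by rewrite /= /vassign !straight_vseq.
  apply: wp_seq; apply: wp_lookup => s3 E3 T3 I3 O3.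
  apply: wp_seq; apply: wp_assign => s4 E4 T4 I4 O4.
  have e3 : rg s3 rv 0 = (inord 0 \in X).
    rewrite E3 [LHS]/= T2 -(tables_X HT) inordK //; congr (T _ [:: _]); exact: mod0n.
  have e4 : rg s4 rF 0 = th k tau.
    rewrite E4 /= -/(rg s3 rv 0) -/(rg s3 rF 0) -/(rg s3 rk 0) -/(rg s3 rL 0) e3 mod0n.
    rewrite /th (top_hits_base X k_gt0 pi_perm tp kL) -/L.
    rewrite !E3 /= hF (ctx_k cx2) (ctx_L cx2).
    have -> : path ltn 0 (take k ps) = sorted ltn [seq index (L - k + y) tau | y <- pi].
      rewrite take_oversize ?size_map ?size_pi_k // path_sortedE; last exact: ltn_trans.
      rewrite (_ : all _ _) ?andTb; last by apply/allP => _ /mapP [y _ ->].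
      by rewrite /ps !sorted_map.
    have kL' : k <= L by exact: kL.
    have -> : (L == k) = ~~ (k < L) by rewrite -leqNgt eqn_leq kL' andbT.
    have sm (x : bool) : x %% 2 ^ w = x.
      by apply: modn_small; apply: leq_ltn_trans W_gt1; case: x.
    rewrite (mulnb (inord 0 \in X)) sm eqb0 mulnb sm; congr nat_of_bool.
    by rewrite andbC negb_and implybE.
  apply: wp_seq; apply: (wp_vassign (v := fun j => th k tau %/ 2 ^ (w * j) %% W)) =>
      [j s' jc h|s5 E5 T5 I5 O5].
    have th1 : th k tau < 2.
      by rewrite /th (top_hits_base X k_gt0 pi_perm tp kL); case: (_ && _).
    case: eqP => [->|/eqP j0].
      rewrite muln0 divn1 -[LHS]/(rg s' rF 0) h // e4 modn_small //.
      exact: leq_trans th1 W_gt1.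
    rewrite ev_lit0 divn_small ?mod0n //; apply: leq_trans th1 _.
    by rewrite -{1}(expn1 2) leq_pexp2l // muln_gt0 w_gt0 lt0n.
  apply: wp_assign => s6 E6 T6 I6 O6.
  split.
  - apply: (ctx_ext cx2) => [g| | |].
    + by rewrite !inE => /or4P [] /eqP ->; rewrite E6 /= E5 /= E4 /= E3.
    + by apply: eq_vec => j _; rewrite E6 /= E5 /= E4 /= E3.
    + by rewrite I6 I5 I4 I3.
    + by rewrite O6 O5 O4 O3.
  - by rewrite -hI2; apply: eq_vec => j _; rewrite E6 /= E5 /= E4 /= E3.
  - by [].
  - by rewrite E6 /= -/(rg s5 rk 0) E5 /= E4 /= E3 /= (ctx_k cx2).
  - transitivity (vec c (rg s2 vA)).
      by apply: eq_vec => j _; rewrite E6 /= E5 /= E4 /= E3.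
    (* The letters [L - k + y] for [y] in [pi] are exactly those above [L - k], so the base loop
       leaves the decremented word that belongs to [i = k]. *)
    rewrite hA; congr pkd; apply/eq_in_map => x; rewrite (mem_perm _ tp) => xL.
    congr (_ - nat_of_bool _); rewrite take_oversize ?size_pi_k //.
    apply/mapP/idP => [[y]|h].
      by rewrite (mem_perm _ pi_perm) => hy ->; move: hy; clear; lia.
    exists (x - (L - k)); last by move: h; clear; lia.
    by rewrite (mem_perm _ pi_perm); move: h xL (kL); rewrite -/L; clear; lia.
  - by apply: eq_vec => j jc; rewrite E6 /= E5 /= jc.
  - by move=> u i K _; rewrite T6 T5 T4 T3 T2.
  - by move=> i; rewrite ltnNge; case: (k <= i).
move=> s3 D3; apply: (@runs_weaken _ _ (k * (1 + max_time (delete_body c)).+1 + 2) _ _ (delete_inv ip op T 0)) => //.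
apply: (runs_while (I := delete_inv ip op T)) D3 => [m s4 D4|s4 D4].
  exact: delete_step.
by rewrite -[eval _ _ _]/(rg s4 rt 0) (di_t D4).
Qed.
End Process.

(** * Linked lists in hash tables *)

Fixpoint chain (nx : seq nat -> seq nat) (st : seq nat) (l : seq (seq nat)) : Prop :=
  if l is d :: l' then st = pkd d /\ chain nx (nx (pkd d)) l' else st = nseq c 0.

Lemma eq_chain nx nx' st l : {in l, forall d, nx' (pkd d) = nx (pkd d)} ->
  chain nx st l -> chain nx' st l.
Proof.
elim: l st => //= d l IH st E [-> h]; split=> //; rewrite E ?mem_head //.
by apply: IH h => x xl; apply: E; rewrite inE xl orbT.
Qed.

Lemma pkd0 : pkd [::] = nseq c 0. Proof. exact: pk_nil. Qed.

Lemma pkd_eq0 d : d \in D -> pkd d != nseq c 0.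
Proof.
move=> dD; rewrite -pkd0; apply/eqP => /pkd_inj; rewrite !inE dD orbT => /(_ isT isT) E.
by have [_] := D_facts dD; rewrite E.
Qed.

Lemma chain_nonzero nx st l : {subset l <= D} -> chain nx st l ->
  (st != nseq c 0) = (l != [::]).
Proof.
case: l => [|d l] h /=; first by move=> ->; rewrite eqxx.
by case=> -> _; rewrite pkd_eq0 // h // mem_head.
Qed.

(** Appending redirects one pointer, that of the last element; distinctness protects the earlier
    ones. The header [x] may be the empty word, whose successor is the first input. *)
Lemma chain_rcons nx nx' x l d :
  {subset rcons (x :: l) d <= [::] :: D} -> uniq (rcons (x :: l) d) ->
  (forall K, nx' K = if K == pkd (last x l) then pkd d else nx K) ->
  nx (pkd d) = nseq c 0 ->
  chain nx (nx (pkd x)) l -> chain nx' (nx' (pkd x)) (rcons l d).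
Proof.
move=> sub un E nd; elim: l x sub un E => [|y l IH] x sub un E /=.
  move=> _; rewrite !E eqxx; split=> //; case: eqP => // /pkd_inj e.
  have : d = x by apply: e; apply: sub; rewrite !inE eqxx ?orbT.
  by move=> e'; move: un; rewrite e' /= inE eqxx.
have ne : (pkd x == pkd (last y l)) = false.
  apply/eqP => /pkd_inj e.
  have {}e : x = last y l.
    apply: e; apply: sub; first by rewrite mem_head.
    by rewrite -cats1 mem_cat inE mem_last orbT.
  move: un; rewrite /= -/(rcons (y :: l) d) => /andP [/negP []].
  by rewrite e mem_rcons inE mem_last orbT.
case=> e h; rewrite E /= ne e; split=> //; apply: IH => //.
- by move=> z zi; apply: sub; rewrite /= inE zi orbT.
- by move: un => /= /andP [].
Qed.

(** Reversed, because reading pushes at the front. *)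
Definition buck (E : seq (seq nat)) l := rev [seq d <- E | size d == l].

Lemma buck_rcons E d l :
  buck (rcons E d) l = if size d == l then d :: buck E l else buck E l.
Proof. by rewrite /buck filter_rcons; case: eqP => // _; rewrite rev_rcons. Qed.

Lemma mem_buck E d l : (d \in buck E l) = (d \in E) && (size d == l).
Proof. by rewrite mem_rev mem_filter andbC. Qed.

(** * Reading the permutations *)

Definition entry d := size d :: pack w b c d ++ pack w b c (perm_inv d).
Definition tape E rest := flatten [seq entry d | d <- E] ++ 0 :: rest.

Record read_inv rest E1 E2 (s : state) : Prop := ReadInv {
  ri_D : D = E1 ++ E2;
  ri_b : rg s rb 0 = b;
  ri_B : rg s rB 0 = B;
  ri_L : rg s rL 0 = head 0 (tape E2 rest);
  ri_in : inp s = behead (tape E2 rest);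
  ri_out : out s = [::];
  ri_last : vec c (rg s vlast) = pkd (last [::] E1);
  ri_inv : forall d, d \in E1 -> vtb (tabs s) tI (pkd d) = pkd (perm_inv d);
  ri_buck : forall l, chain (vtb (tabs s) tNB) (vtb (tabs s) tHB [:: l]) (buck E1 l);
  ri_order : chain (vtb (tabs s) tNO) (vtb (tabs s) tNO (nseq c 0)) E1;
  ri_order0 : forall d, d \in E2 -> vtb (tabs s) tNO (pkd d) = nseq c 0;
  ri_P : forall K, vtb (tabs s) tP K = nseq c 0 }.

Lemma vtb_upd T T' t K0 v :
  (forall u i K, T' (enc u i) K =
     if [&& u == t, i < c & K == K0] then v i else T (enc u i) K) ->
  forall u K, vtb T' u K = if (u == t) && (K == K0) then vec c v else vtb T u K.
Proof.
move=> E u K; case: ifP => h; apply: eq_vec => j jc; rewrite E jc.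
  by rewrite h.
by rewrite andTb h.
Qed.

Lemma vec_nth l r : size l = c -> vec c (nth 0 (l ++ r)) = l.
Proof.
move=> sl; apply: (@eq_from_nth _ 0); rewrite size_map size_iota ?sl // => i ic.
by rewrite nth_vec // nth_cat sl ic.
Qed.

Lemma straight_read : straight (read_body c).
Proof. by do !(apply/andP; split; first exact: straight_vseq). Qed.

Lemma read_step rest E1 d E2 s : read_inv rest E1 (d :: E2) s ->
  runs w (read_body c) (max_time (read_body c)) s (read_inv rest (rcons E1 d) E2).
Proof.
case=> hD hb hB hL hin hout hlast hinv hbuck horder horder0 hP.
apply: runs_straight; first exact: straight_read.
have hD' : D = rcons E1 d ++ E2 by rewrite cat_rcons.
have dD : d \in D by rewrite hD mem_cat mem_head orbT.
have sub1 : {subset E1 <= D} by move=> x xE; rewrite hD mem_cat xE.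
have sub2 : {subset E2 <= D} by move=> x xE; rewrite hD mem_cat inE xE !orbT.
have un := D_uniq; rewrite hD' cat_uniq rcons_uniq in un.
case/and3P: un => [/andP [dE1 uE1] /hasPn dj uE2].
have neq x : x \in D -> x != d -> (pkd x == pkd d) = false.
  move=> xD /eqP ne; apply/eqP => /pkd_inj e; apply: ne.
  by apply: e; rewrite inE ?xD ?dD orbT.
have {hin} hin : inp s = pkd d ++ (pkd (perm_inv d) ++ tape E2 rest).
  by rewrite hin /tape /= /entry !packE -!catA.
have {hL} hL : rg s rL 0 = size d by rewrite hL.
apply: wp_seq; apply: wp_vread => s1 E1_ T1 I1 O1.
apply: wp_seq; apply: wp_vread => s2 E2_ T2 I2 O2.
have I1' : inp s1 = pkd (perm_inv d) ++ tape E2 rest.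
  by rewrite I1 hin drop_size_cat // size_pkd.
have I2' : inp s2 = tape E2 rest.
  by rewrite I2 I1' drop_size_cat // size_pkd.
have kT : vec c (rg s2 vT) = pkd d.
  by rewrite (vec_upd E2_) /= (vec_upd E1_) /= hin vec_nth // size_pkd.
have kI : vec c (rg s2 vI) = pkd (perm_inv d).
  by rewrite (vec_upd E2_) /= I1' vec_nth // size_pkd.
have kL : rg s2 rL 0 = size d by rewrite E2_ /= E1_ /= hL.
have kl : vec c (rg s2 vlast) = pkd (last [::] E1).
  by rewrite (vec_upd E2_) /= (vec_upd E1_) /= hlast.
apply: wp_seq; apply: wp_vinsert => s3 E3 T3 I3 O3.
rewrite eval_keys kT in T3.
have V3 := vtb_upd T3; rewrite -[vec c (fun i => _)]/(vec c (rg s2 vI)) kI in V3.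
apply: wp_seq; apply: (wp_vlookup (K := [:: size d])) => [s' h|s4 E4 T4 I4 O4].
  by rewrite /= -/(rg s' rL 0) h // E3 kL.
have kq : vec c (rg s4 vq) = vtb (tabs s) tHB [:: size d].
  by rewrite (vec_upd E4) /= -[vec c (fun i => _)]/(vtb (tabs s3) tHB [:: size d]) V3 /= T2 T1.
apply: wp_seq; apply: wp_vinsert => s5 E5 T5 I5 O5.
have kT4 : vec c (rg s4 vT) = pkd d.
  by rewrite (vec_upd E4) /= -kT; apply: eq_vec => j _; rewrite E3.
rewrite eval_keys kT4 in T5.
have V5 := vtb_upd T5; rewrite -[vec c (fun i => _)]/(vec c (rg s4 vq)) kq in V5.
apply: wp_seq; apply: wp_vinsert => s6 E6 T6 I6 O6.
rewrite /= -/(rg s5 rL 0) E5 E4 /= E3 kL in T6.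
have kT5 : vec c (rg s5 vT) = pkd d by rewrite -kT4; apply: eq_vec => j _; rewrite E5.
have V6 := vtb_upd T6; rewrite -[vec c (fun i => _)]/(vec c (rg s5 vT)) kT5 in V6.
apply: wp_seq; apply: wp_vinsert => s7 E7 T7 I7 O7.
have kl6 : vec c (rg s6 vlast) = pkd (last [::] E1).
  by rewrite -kl; apply: eq_vec => j _; rewrite E6 E5 E4 /= E3.
rewrite eval_keys kl6 in T7.
have kT6 : vec c (rg s6 vT) = pkd d by rewrite -kT5; apply: eq_vec => j _; rewrite E6.
have V7 := vtb_upd T7; rewrite -[vec c (fun i => _)]/(vec c (rg s6 vT)) kT6 in V7.
apply: wp_seq; apply: (wp_vassign (v := rg s7 vT)) => [j s' jc h|s8 E8 T8 I8 O8].
  by rewrite -[LHS]/(rg s' vT j) h.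
apply: wp_read => s9 E9 T9 I9 O9.
have I8' : inp s8 = tape E2 rest by rewrite I8 I7 I6 I5 I4 I3 I2'.
have T9' : tabs s9 = tabs s7 by rewrite T9 T8.
have T2' : tabs s2 = tabs s by rewrite T2 T1.
have vI u K : u \notin [:: tI; tNB; tHB; tNO] -> vtb (tabs s9) u K = vtb (tabs s) u K.
  rewrite !inE !negb_or T9' V7 V6 V5 T4 V3 T2' => /and4P [/negbTE -> /negbTE -> /negbTE -> /negbTE ->].
  by [].
have NB K : vtb (tabs s9) tNB K = if K == pkd d then vtb (tabs s) tHB [:: size d] else vtb (tabs s) tNB K.
  by rewrite T9' V7 /= V6 /= V5 /= T4 V3 /= T2'.
have HBE K : vtb (tabs s9) tHB K = if K == [:: size d] then pkd d else vtb (tabs s) tHB K.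
  by rewrite T9' V7 /= V6 /= V5 /= T4 V3 /= T2'.
have NO K : vtb (tabs s9) tNO K = if K == pkd (last [::] E1) then pkd d else vtb (tabs s) tNO K.
  by rewrite T9' V7 /= V6 /= V5 /= T4 V3 /= T2'.
have IE K : vtb (tabs s9) tI K = if K == pkd d then pkd (perm_inv d) else vtb (tabs s) tI K.
  by rewrite T9' V7 /= V6 /= V5 /= T4 V3 /= T2'.
split=> //.
- by rewrite E9 /= E8 /= E7 E6 E5 E4 /= E3 E2_ /= E1_.
- by rewrite E9 /= E8 /= E7 E6 E5 E4 /= E3 E2_ /= E1_.
- by rewrite E9 /= I8'.
- by rewrite I9 I8'.
- by rewrite O9 O8 O7 O6 O5 O4 O3 O2 O1.
- rewrite last_rcons (vec_upd1 c E9) // (vec_upd E8) /= -kT6.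
  by apply: eq_vec => j _; rewrite E7.
- move=> x; rewrite mem_rcons inE IE => /orP [/eqP ->|xE]; first by rewrite eqxx.
  rewrite neq ?hinv ?sub1 //; by apply: contraNneq dE1 => <-.
- move=> l; rewrite buck_rcons HBE eqseq_cons andbT (eq_sym l).
  (* The only new pointer of this kind starts at [d], which is not yet in any list. *)
  have old : chain (vtb (tabs s9) tNB) (vtb (tabs s) tHB [:: l]) (buck E1 l).
    apply: eq_chain (hbuck l) => x; rewrite mem_buck NB => /andP [xE _].
    rewrite neq ?sub1 //; by apply: contraNneq dE1 => <-.
  by case: eqP old => // <- old; split=> //; rewrite NB eqxx.
- rewrite -pkd0; apply: (@chain_rcons (vtb (tabs s) tNO)) => //.
  + move=> x; rewrite mem_rcons !inE => /or3P [/eqP ->|->|/sub1 ->]; rewrite ?dD ?orbT //.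
  + rewrite rcons_uniq /= uE1 andbT inE negb_or dE1 andbT; apply/andP; split.
      by apply: contraTneq dD => ->; apply/negP => /D_facts [].
    by apply/negP => /sub1 /D_facts [].
  + by apply: horder0; rewrite mem_head.
  + by rewrite pkd0.
- move=> x xE; rewrite NO; case: eqP => [/pkd_inj e|_].
    have {}e : x = last [::] E1.
      apply: e; rewrite inE ?(sub2 x) ?orbT //.
      by have := mem_last [::] E1; rewrite !inE => /orP [->//|/sub1 ->]; rewrite orbT.
    have := mem_last [::] E1; rewrite -e inE => /orP [/eqP x0|xE1].
      by have [_] := D_facts (sub2 _ xE); rewrite x0.
    by have := dj _ xE; rewrite mem_rcons inE xE1 orbT.
  by apply: horder0; rewrite inE xE orbT.
- by move=> K; rewrite vI.
Qed.

Record load_inv t xs rest (s0 : state) m (s : state) : Prop := LoadInv {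
  li_m : m <= k;
  li_t : rg s rt 0 = k - m;
  li_k : rg s rk 0 = k;
  li_in : inp s = drop (k - m) xs ++ rest;
  li_out : out s = out s0;
  li_reg : forall g j, g \notin [:: rt; rv] -> rg s g j = rg s0 g j;
  li_tab : forall u i K, (u != t) || (K == [:: 0]) ->
    tabs s (enc u i) K = tabs s0 (enc u i) K;
  li_val : forall i, i < k - m -> tabs s (enc t 0) [:: i.+1] = nth 0 xs i }.

Lemma load_step t xs rest s0 m s : size xs = k -> load_inv t xs rest s0 m.+1 s ->
  runs w (load_body t) (max_time (load_body t)) s (load_inv t xs rest s0 m).
Proof.
move=> sx [mk ht hk hin hout hreg htab hval]; apply: runs_straight => //.
have km : (k - m.+1).+1 = k - m by move: mk; clear; lia.
set t0 := k - m.+1 in ht hin hval km.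
have t0k : t0 < k by rewrite /t0; move: mk; clear; lia.
have hin' : inp s = nth 0 xs t0 :: drop (k - m) xs ++ rest.
  by rewrite hin (drop_nth 0) ?sx // km.
apply: wp_seq; apply: wp_assign => s1 E1 T1 I1 O1.
apply: wp_seq; apply: wp_read => s2 E2 T2 I2 O2.
apply: wp_insert => s3 E3 T3 I3 O3.
have e1 : rg s1 rt 0 = k - m.
  rewrite E1 /= -/(eval w s (Lit 1)) ev_lit1 -/(rg s rt 0) ht addn1 km modn_small //.
  by apply: leq_ltn_trans kW; apply: leq_subr.
have e2 : rg s2 rt 0 = k - m by rewrite E2.
have v2 : rg s2 rv 0 = nth 0 xs t0 by rewrite E2 /= I1 hin'.
rewrite /= -/(rg s2 rt 0) -/(rg s2 rv 0) e2 v2 in T3.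
split.
- exact: ltnW.
- by rewrite E3.
- by rewrite E3 E2 /= E1.
- by rewrite I3 I2 I1 hin'.
- by rewrite O3 O2 O1.
- move=> g j h; rewrite E3 E2 E1 -hreg //.
  by move: h; rewrite !inE negb_or => /andP [/negbTE -> /negbTE ->].
- move=> u i K h; rewrite T3 T2 T1 -htab //; case: and3P => // - [/eqP hu _ /eqP hK].
  by move: h; rewrite hu hK eqxx -km.
- move=> i; rewrite -km ltnS T3 eqxx eqseq_cons andbT -km eqSS /= leq_eqVlt.
  by case: eqP => [->//|_ /= h]; rewrite T2 T1 hval.
Qed.

(** * The main loop over increasing lengths *)

Record links (T : nat -> seq nat -> nat) : Prop := Links {
  lk_buck : forall l, chain (vtb T tNB) (vtb T tHB [:: l]) (buck D l);
  lk_order : chain (vtb T tNO) (vtb T tNO (nseq c 0)) D }.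

Lemma links_ext T T' : (forall u i K, u \in [:: tNB; tHB; tNO] ->
  T' (enc u i) K = T (enc u i) K) -> links T -> links T'.
Proof.
move=> E; have E' u K : u \in [:: tNB; tHB; tNO] -> vtb T' u K = vtb T u K.
  by move=> h; apply: eq_vec => j _; rewrite E.
case=> h1 h2; split=> [l|]; rewrite E' //; apply: eq_chain; eauto => d _; exact: E'.
Qed.

(* [bs] lists the permutations of length [l] still to be processed, [m] counts all
   permutations still to be processed; those shorter than [k] have no hits, which is
   what their unwritten table entries say. *)
Record main_inv l bs m (s : state) : Prop := MainInv {
  mi_b : rg s rb 0 = b;
  mi_B : rg s rB 0 = B;
  mi_k : rg s rk 0 = k;
  mi_L : bs != [::] -> rg s rL 0 = l;
  mi_out : out s = [::];
  mi_tables : tables (tabs s);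
  mi_links : links (tabs s);
  mi_chain : chain (vtb (tabs s) tNB) (vec c (rg s vT)) bs;
  mi_bs : forall d, d \in bs -> d \in D /\ size d = l;
  mi_uniq : uniq bs;
  mi_end : bs = [::] -> {in D, forall d, size d <= l};
  mi_m : m = size bs + count (fun d => l < size d) D;
  mi_P : forall sg, sg \in [::] :: D ->
    (size sg < k) || ~~ ((l < size sg) || (sg \in bs)) ->
    forall i, i < k -> vtb (tabs s) tP (pkd sg ++ [:: i]) = digits w c (th i sg) }.

(** For [l <= n] the increment wraps around only if it reaches [2 ^ w]. Neither [2 ^ w] nor 0 is a
    length between 1 and [n], so both lists are empty. *)
Lemma buck0 l : buck D (l.+1 %% W) = buck D l.+1 \/ n < l.
Proof.
case: (ltnP n l) => [|ln]; first by right.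
left; case: (ltnP l.+1 W) => h; first by rewrite modn_small.
have -> : l.+1 = W by apply/eqP; rewrite eqn_leq h andbT; apply: leq_ltn_trans nW.
rewrite modnn.
suff E x : (x == 0) || (n < x) -> buck D x = [::] by rewrite !E ?eqxx ?nW ?orbT.
move=> hx; case E : (buck D x) => [|d r] //.
have : d \in buck D x by rewrite E mem_head.
rewrite mem_buck => /andP [/D_facts [_ h1 h2 _] /eqP e]; move: hx h1 h2; rewrite e.
by clear; lia.
Qed.

(** Witnessed by the standardized prefix of length [l]. The lengths in [D] thus have no gaps, and
    the main loop may stop at the first empty list. *)
Lemma down_size l d : d \in D -> 0 < l <= size d -> buck D l != [::].
Proof.
move=> dD /andP [l0 ls]; pose e := std (take l d).
have se : size e = l by rewrite size_map size_takel.
have eD : e \in D.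
  apply: D_down dD (take_subseq _ _) _.
  by rewrite -size_eq0 size_takel // -lt0n.
apply: contraTneq (_ : e \in buck D l) => [->//|].
by rewrite mem_buck eD se eqxx.
Qed.

Lemma straight_advance : straight (advance c).
Proof.
by do !(apply/andP; split => //; try exact: straight_vseq).
Qed.

Lemma advance_spec l d bs m s : 
  rg s rb 0 = b -> rg s rB 0 = B -> rg s rk 0 = k -> rg s rL 0 = l -> out s = [::] ->
  tables (tabs s) -> links (tabs s) ->
  chain (vtb (tabs s) tNB) (vec c (rg s vT)) (d :: bs) ->
  (forall x, x \in bs -> x \in D /\ size x = l) -> uniq bs -> 0 < l -> l <= n ->
  m = size bs + count (fun d => l < size d) D ->
  (forall sg, sg \in [::] :: D ->
    (size sg < k) || ~~ ((l < size sg) || (sg \in bs)) ->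
    forall i, i < k -> vtb (tabs s) tP (pkd sg ++ [:: i]) = digits w c (th i sg)) ->
  wp w (advance c) s (fun s' => exists l bs, main_inv l bs m s').
Proof.
move=> hb hB hk hL hout hT hlk [hd hch] hbs ubs l0 ln hm hP.
apply: wp_seq; apply: (wp_vlookup (K := pkd d)) => [s' h|s1 E1 T1 I1 O1].
  by rewrite eval_keys -hd; apply: eq_vec => j _; rewrite h.
apply: wp_seq; apply: (wp_vassign (v := rg s1 vq)) => [j s' jc h|s2 E2 T2 I2 O2].
  by rewrite -[LHS]/(rg s' vq j) h.
have T2' : tabs s2 = tabs s by rewrite T2 T1.
have kT : vec c (rg s2 vT) = vtb (tabs s) tNB (pkd d) by rewrite (vec_upd E2) /= (vec_upd E1).
have sub : {subset bs <= D} by move=> x /hbs [].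
have nz := chain_nonzero sub hch.
apply: wp_if; rewrite ?ev_nz => hz.
  exists l, bs; split; rewrite ?T2' //.
  - by rewrite E2 /= E1.
  - by rewrite E2 /= E1.
  - by rewrite E2 /= E1.
  - by rewrite E2 /= E1.
  - by rewrite O2 O1.
  - by rewrite kT.
  - by move=> e; move: hz; rewrite kT nz e.
have bs0 : bs = [::].
  apply/eqP; rewrite -[_ == _]negbK -nz -kT -(ev_nz w c s2 vT) hz //.
apply: wp_seq; apply: wp_assign => s3 E3 T3 I3 O3.
have e3 : rg s3 rL 0 = l.+1 %% W.
  by rewrite E3 /= -/(eval w s2 (Lit 1)) ev_lit1 -/(rg s2 rL 0) E2 /= E1 /= hL addn1.
apply: (wp_vlookup (K := [:: l.+1 %% W])) => [s' h|s4 E4 T4 I4 O4].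
  by rewrite /= -/(rg s' rL 0) h // e3.
have T4' : tabs s4 = tabs s by rewrite T4 T3 T2'.
have kT4 : vec c (rg s4 vT) = vtb (tabs s) tHB [:: l.+1 %% W].
  by rewrite (vec_upd E4) /= T3 T2'.
have bE : buck D (l.+1 %% W) = buck D l.+1.
  by case: (buck0 l) => //; rewrite ltnNge ln.
exists l.+1, (buck D l.+1); split; rewrite ?T4' //.
- by rewrite E4 /= E3 /= E2 /= E1.
- by rewrite E4 /= E3 /= E2 /= E1.
- by rewrite E4 /= E3 /= E2 /= E1.
- move=> ne; rewrite E4 /= e3 modn_small //.
  case E : (buck D l.+1) ne => [|x r] // _.
  have : x \in buck D l.+1 by rewrite E mem_head.
  rewrite mem_buck => /andP [/D_facts [_ _ xn _] /eqP <-].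
  exact: leq_ltn_trans nW.
- by rewrite O4 O3 O2 O1.
- rewrite kT4 -bE; exact: lk_buck.
- by move=> x; rewrite mem_buck => /andP [-> /eqP].
- by rewrite rev_uniq filter_uniq.
- move=> e x xD; rewrite leqNgt; apply/negP => lt.
  have := @down_size l.+1 x xD; rewrite e => /(_ (ltnW lt)).
  by [].
- rewrite hm bs0 add0n size_rev size_filter -count_predUI.
  rewrite [X in _ + X](_ : _ = 0) ?addn0; last first.
    rewrite -(count_pred0 D); apply: eq_count => x /=; by case: (ltngtP l.+1 (size x)).
  by apply: eq_count => x /=; rewrite (leq_eqVlt l.+1) eq_sym.
- move=> sg sD h; apply: hP => //; move: h; case: (size sg < k) => //=.
  rewrite bs0 in_nil orbF mem_buck negb_or -!leqNgt => /andP [h1 h2].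
  rewrite leq_eqVlt ltnS in h1; case/orP: h1 => // /eqP h1.
  move: sD h2; rewrite inE h1 eqxx andbT => /orP [/eqP e|->//].
  by rewrite e in h1.
Qed.

Lemma main_step m s : (exists l bs, main_inv l bs m.+1 s) ->
  eval w s (enz c vT) != 0 /\
  runs w (main_body c) ((3 + process_time c * k.+1).+1 + max_time (advance c)) s
    (fun s' => exists l bs, main_inv l bs m s').
Proof.
case=> l [bs [hb hB hk hL hout hT hlk hch hbs ubs hend hm hP]].
case: bs => [|d bs] in hL hch hbs ubs hend hm hP *.
  move: hm; rewrite add0n (eq_in_count (a2 := pred0)) ?count_pred0 // => x xD.
  by rewrite ltnNge hend.
have {}hL := hL isT; have [dD dl] := hbs d (mem_head _ _).
have [dp d0 dn _] := D_facts dD.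
split.
  rewrite ev_nz (chain_nonzero _ hch) // => x /hbs [] //.
apply: runs_seq.
have lt : l <= n by rewrite -dl.
have l0 : 0 < l by rewrite -dl.
have hbs' x : x \in bs -> x \in D /\ size x = l by move=> xb; apply: hbs; rewrite inE xb orbT.
have [dbs ubs'] := andP ubs.
apply: runs_if => h.
  apply: (@runs_weaken _ _ 1 _ _ (fun s' => s' = s)) => //.
  - by exists 1, s; split=> //; constructor.
  - by rewrite (leq_trans _ (leq_pmulr _ _)) // /process_time addn2.
  move=> _ ->; apply: runs_straight; first exact: straight_advance.
  apply: advance_spec hch hbs' ubs' l0 lt _ _ => //.
    by move: hm; rewrite /= addSn => - [].
  have {}h : size d < k.
    have E : eval w s (Bin Less (R rL) (R rk)) = (rg s rL 0 < rg s rk 0) by [].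
    by move: h; rewrite E hL hk dl; case: (l < k).
  move=> sg sD hs; apply: hP => //; rewrite inE.
  by case: (eqVneq sg d) => [->|_]; [rewrite h|].
have kd : k <= size d.
  have E : eval w s (Bin Less (R rL) (R rk)) = (rg s rL 0 < rg s rk 0) by [].
  by move: h; rewrite E hL hk dl ltnNge; case: (k <= l).
apply: (@runs_weaken _ _ _ _ _ (delete_inv d (inp s) [::] (tabs s) 0)) (leqnn _) _.
  apply: process_spec => //; first by split=> //; [rewrite dl|case: hch].
  (* Deleted words have length [l - 1], so they lie neither among the longer permutations nor in the
     rest of the current list: their counts are final. *)
  move=> sg sD hs; apply: hP => //; apply/orP; right; rewrite negb_or.
  rewrite -leqNgt hs dl leq_pred /=; apply/negP => /hbs [_].
  by rewrite hs dl => e; move: l0; rewrite -e; case: (l) e => // ? /eqP; rewrite /= ltn_eqF.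
move=> s' [cx _ _ _ _ _ hother hdone].
apply: runs_straight; first exact: straight_advance.
apply: (advance_spec (l := l) (d := d) (bs := bs)) => //.
- exact: ctx_b cx.
- exact: ctx_B cx.
- exact: ctx_k cx.
- by rewrite (ctx_L cx).
- exact: ctx_out cx.
- by apply: tables_ext hT => u i K h'; rewrite hother // h'.
- apply: links_ext hlk => u i K h'; rewrite hother //.
  by move: h'; rewrite !inE => /or3P [] /eqP ->.
- case: hch => e hch; split; first exact: ctx_T cx.
  have E K : vtb (tabs s') tNB K = vtb (tabs s) tNB K by apply: eq_vec => j _; rewrite hother.
  by rewrite E; apply: eq_chain hch => x _; rewrite E.
- by move: hm; rewrite /= addSn => - [].
move=> sg sD hs i ik; case: (eqVneq sg d) => [->|ne]; first exact: hdone.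
rewrite -hP // ?inE ?(negbTE ne) //; apply: eq_vec => j _; rewrite hother //.
apply/orP; right; apply/mapP => - [i' _] /key_inj [/pkd_inj e _].
by case/eqP: ne; apply: e => //; rewrite inE dD orbT.
Qed.

(** * Writing the counts, and the whole computation for nonempty [D] *)

Record output_inv T m (s : state) : Prop := OutputInv {
  oi_tabs : tabs s = T;
  oi_lists : exists E1 E2, [/\ D = E1 ++ E2, size E2 = m,
    chain (vtb T tNO) (vec c (rg s vT)) E2 &
    out s = flatten [seq digits w c (hits pi X d) | d <- E1]] }.

Lemma output_step T m s :
  (forall d, d \in D -> vtb T tP (pkd d ++ [:: 0]) = digits w c (th 0 d)) ->
  output_inv T m.+1 s -> eval w s (enz c vT) != 0 /\
  runs w (output_body c) (max_time (output_body c)) s (output_inv T m).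
Proof.
move=> hP [hT [E1 [[|d E2] [hD sE hch hout]]]] //.
have sub : {subset d :: E2 <= D} by move=> x xE; rewrite hD mem_cat xE orbT.
split; first by rewrite ev_nz (chain_nonzero _ hch).
case: hch => hd hch; apply: runs_straight.
  by do !(apply/andP; split; try exact: straight_vseq); exact: straight_vseq.
apply: wp_seq; apply: (wp_vlookup (K := pkd d ++ [:: 0])) => [s' h|s1 E1_ T1 I1 O1].
  rewrite map_cat eval_keys /= mod0n -hd; congr (_ ++ _).
  by apply: eq_vec => j _; rewrite h.
apply: wp_seq; apply: wp_vwrite => s2 E2_ T2 I2 O2.
apply: wp_seq; apply: (wp_vlookup (K := pkd d)) => [s' h|s3 E3 T3 I3 O3].
  by rewrite eval_keys -hd; apply: eq_vec => j _; rewrite h // E2_ E1_.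
apply: (wp_vassign (v := rg s3 vq)) => [j s' jc h|s4 E4 T4 I4 O4].
  by rewrite -[LHS]/(rg s' vq j) h.
have T2' : tabs s2 = T by rewrite T2 T1.
split; first by rewrite T4 T3.
exists (rcons E1 d), E2; split.
- by rewrite cat_rcons.
- by case: sE.
- by rewrite (vec_upd E4) /= (vec_upd E3) /= T2'.
- rewrite O4 O3 O2 O1 hout map_rcons -cats1 flatten_cat /= cats0; congr (_ ++ _).
  rewrite hitsE -hP; last by apply: sub; rewrite mem_head.
  by rewrite -[LHS]/(vec c (rg s1 vq)) (vec_upd E1_) /= hT.
Qed.

Lemma digits0 : digits w c 0 = nseq c 0.
Proof.
apply: (@eq_from_nth _ 0); rewrite size_map size_iota ?size_nseq // => j jc.
by rewrite (nth_map 0) ?size_iota // nth_nseq jc div0n mod0n.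
Qed.

Let Xs := [seq nat_of_bool (x \in X) | x <- enum 'I_k.+1].

Lemma nth_Xs (x : 'I_k.+1) : nth 0 Xs x = (x \in X).
Proof.
rewrite (nth_map ord0) ?size_enum_ord //; congr (nat_of_bool (_ \in X)).
by apply: val_inj; rewrite /= nth_enum_ord.
Qed.

Lemma eval_less s f g : eval w s (Bin Less (R f) (R g)) = (rg s f 0 < rg s g 0).
Proof. by []. Qed.

Lemma load_loop t xs rest s0 s : size xs = k -> load_inv t xs rest s0 k s ->
  runs w (While (Bin Less (R rt) (R rk)) (load_body t))
    (k * (3 + max_time (load_body t)).+1 + 4) s (load_inv t xs rest s0 0).
Proof.
move=> sx; apply: (runs_while (I := load_inv t xs rest s0)) => [m s1 L1|s1 L1].
  split; last exact: load_step.
  by rewrite eval_less (li_t L1) (li_k L1); have := li_m L1; clear; lia.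
by rewrite eval_less (li_t L1) (li_k L1) subn0 ltnn.
Qed.

Lemma count_spec s : D != [::] -> read_inv (k :: pi ++ Xs) D [::] s ->
  runs w (count_prog c) (count_time c k (size D)) s
    (fun s' => out s' = output_tape w c pi X D).
Proof.
move=> D0 [_ hb hB hL hin hout hlast hinv hbuck horder _ hP].
have XsE : Xs = (ord0 \in X : nat) :: behead Xs by rewrite /Xs enum_ordSl.
have sX : size (behead Xs) = k by rewrite size_behead size_map size_enum_ord.
have km : k - k = 0 by rewrite subnn.
apply: runs_seq; apply: runs_straight => //.
apply: wp_seq; apply: wp_read => s1 E1 T1 I1 O1.
apply: wp_assign => s2 E2 T2 I2 O2.
have T2' : tabs s2 = tabs s by rewrite T2 T1.
apply: runs_seq; apply: runs_weaken (leqnn _) _.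
  apply: (@load_loop tPI pi Xs s2); first exact: size_pi_k.
  split=> //; rewrite ?subnn ?drop0 //.
  - by rewrite E2 /= mod0n.
  - by rewrite E2 /= E1 /= hin.
  - by rewrite I2 I1 hin.
move=> s3 [_ _ k3 in3 out3 reg3 tab3 val3]; rewrite subn0 in in3 val3.
rewrite drop_oversize ?size_pi_k // in in3.
apply: runs_seq; apply: runs_straight => //.
apply: wp_seq; apply: wp_assign => s4 E4 T4 I4 O4.
apply: wp_seq; apply: wp_read => s5 E5 T5 I5 O5.
apply: wp_insert => s6 E6 T6 I6 O6.
have I4' : inp s4 = Xs by rewrite I4 in3.
have T6' u i K : tabs s6 (enc u i) K =
    if [&& u == tX, i == 0 & K == [:: 0]] then ord0 \in X : nat else tabs s3 (enc u i) K.
  rewrite T6 /= -/(rg s5 rt 0) -/(rg s5 rv 0) E5 /= E4 /= mod0n E5 /= I4' XsE /=.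
  by rewrite T5 T4.
apply: runs_seq; apply: runs_weaken (leqnn _) _.
  apply: (@load_loop tX (behead Xs) [::] s6) => //.
  split=> //; rewrite ?subnn ?drop0 ?cats0 //.
  - by rewrite E6 E5 /= E4 /= mod0n.
  - by rewrite E6 E5 /= E4 /= k3.
  - by rewrite I6 I5 I4'.
move=> s7 [_ _ k7 _ out7 reg7 tab7 val7]; rewrite subn0 in val7.
have tabE u i K : u \notin [:: tPI; tX] -> tabs s7 (enc u i) K = tabs s (enc u i) K.
  rewrite !inE negb_or => /andP [u1 u2].
  by rewrite tab7 ?u2 // T6' (negbTE u2) tab3 ?u1 // T2'.
have vtbE u K : u \notin [:: tPI; tX] -> vtb (tabs s7) u K = vtb (tabs s) u K.
  by move=> h; apply: eq_vec => j _; apply: tabE.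
have HT : tables (tabs s7).
  split=> [d dD|t tk|x]; first by rewrite vtbE // hinv.
    by rewrite tab7 // T6' /= val3.
  case: (unliftP ord0 x) => [y ->|->].
    rewrite lift0 val7 // -(nth_Xs (lift ord0 y)) lift0 XsE /=.
    by case: (behead Xs).
  by rewrite tab7 // T6'.
have HL : links (tabs s7).
  apply: (@links_ext (tabs s)); last by split.
  by move=> u i K; rewrite !inE => /or3P [] /eqP ->; rewrite tabE.
have reg s' g j : (forall g i, rg s' g i = rg s7 g i) ->
    g \notin [:: rt; rv; rk] -> rg s' g j = rg s g j.
  move=> h; rewrite !inE !negb_or => /and3P [g1 g2 g3].
  rewrite h reg7 ?inE ?negb_or ?g1 // E6 E5 E4 (negbTE g1) (negbTE g2) /=.
  by rewrite reg3 ?inE ?negb_or ?g1 // E2 E1 (negbTE g1) (negbTE g3).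
apply: runs_seq; apply: runs_straight; first by rewrite /= straight_vseq.
apply: wp_seq; apply: wp_assign => s8 E8 T8 I8 O8.
apply: (wp_vlookup (K := [:: 1])) => [s' h|s9 E9 T9 I9 O9].
  by rewrite /= -/(rg s' rL 0) h // E8 /= modn_small // W_gt1.
have T9' : tabs s9 = tabs s7 by rewrite T9 T8.
have [d0 d0D] : exists d, d \in D by case: (D) D0 => // d E _; exists d; rewrite mem_head.
have M0 : main_inv 1 (buck D 1) (size D) s9.
  split; rewrite ?T9' //.
  - by rewrite E9 /= E8 /= (reg s7).
  - by rewrite E9 /= E8 /= (reg s7).
  - by rewrite E9 /= E8 /= k7.
  - by move=> _; rewrite E9 /= E8 /= modn_small // W_gt1.
  - by rewrite O9 O8 out7 O6 O5 O4 out3 O2 O1.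
  - rewrite (vec_upd E9) /= T8; exact: lk_buck.
  - by move=> x; rewrite mem_buck => /andP [-> /eqP].
  - by rewrite rev_uniq filter_uniq.
  - have [_ s0 _ _] := D_facts d0D.
    by move=> e; have := @down_size 1 d0 d0D; rewrite e s0 => /(_ isT).
  - rewrite size_rev size_filter -(count_predC (fun x => size x == 1)); congr (_ + _).
    apply: eq_in_count => x /D_facts [_ x0 _ _] /=.
    by case: (size x) x0 => [|[]].
  - move=> sg sD hs i ik.
    (* Before the first step every nonempty word of [D] is still to be processed, so the entries
       required to be right are those of words shorter than [k], the empty word included. *)
    have sk : size sg < k.
      case/orP: hs => // ; rewrite mem_buck negb_or -leqNgt => /andP [h1].
      move: sD; rewrite inE => /orP [/eqP -> //|sD]; rewrite sD /=.
      by have [_ + _ _] := D_facts sD; case: (size sg) h1 => [|[]].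
    by rewrite vtbE // hP /th top_hits_small // digits0.
apply: runs_seq; apply: runs_weaken (leqnn _) _.
  apply: (runs_while (I := fun m s' => exists l bs, main_inv l bs m s')) => [m s'||].
  - exact: main_step.
  - move=> s' [l [bs M]]; apply/eqP; rewrite -[_ == _]negbK ev_nz.
    rewrite (chain_nonzero _ (mi_chain M)); last by move=> x /(mi_bs M) [].
    by rewrite negbK -size_eq0; have := mi_m M; case: (size bs).
  - by exists 1, (buck D 1); exact: M0.
move=> s10 [l [bs M]].
have bs0 : bs = [::] by apply/eqP; rewrite -size_eq0; have := mi_m M; case: (size bs).
apply: runs_seq; apply: runs_straight; first exact: straight_vseq.
apply: (wp_vlookup (K := nseq c 0)) => [s' h|s11 E11 T11 I11 O11].
  by rewrite map_nseq /= mod0n.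
apply: runs_weaken (leqnn _) _.
  apply: (runs_while (I := output_inv (tabs s10))) => [m s'||].
  - apply: output_step => d dD; apply: (mi_P M) => //; first by rewrite inE dD orbT.
    by rewrite bs0 in_nil orbF -leqNgt (mi_end M) ?orbT.
  - move=> s' [_ [E [[|d E'] [hD sE hch _]]]] //; apply/eqP.
    by rewrite -[_ == _]negbK ev_nz (chain_nonzero _ hch).
  - split=> //; exists [::], D; split=> //; last by rewrite O11 (mi_out M).
    by rewrite (vec_upd E11) /=; exact: lk_order (mi_links M).
move=> s12 [_ [E [[|d E'] [hD sE _ ->]]]] //.
by rewrite hD cats0.
Qed.

End Algorithm.

(** * Initialization, time bound and the theorem *)

Lemma vec0 c : vec c (fun=> 0) = nseq c 0.
Proof.
apply: (@eq_from_nth _ 0); rewrite size_map size_iota ?size_nseq // => j jc.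
by rewrite nth_vec // nth_nseq jc.
Qed.

Lemma init_spec w b c n D rest Q :
  (forall s, read_inv w b c D rest [::] D s -> Q s) ->
  wp w init_prog (init_state [:: w, b, n & tape w b c D rest]) Q.
Proof.
move=> HQ; apply: wp_seq; apply: wp_read => s1 E1 T1 I1 O1.
apply: wp_seq; apply: wp_read => s2 E2 T2 I2 O2.
apply: wp_seq; apply: wp_assign => s3 E3 T3 I3 O3.
apply: wp_seq; apply: wp_read => s4 E4 T4 I4 O4.
apply: wp_read => s5 E5 T5 I5 O5; apply: HQ.
have T0 u K : vtb c (tabs s5) u K = nseq c 0.
  by rewrite T5 T4 T3 T2 T1; exact: vec0.
have I4' : inp s4 = tape w b c D rest by rewrite I4 I3 I2 I1.
split=> //.
- by rewrite E5 /= E4 /= E3 /= E2 /= I1.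
- rewrite E5 /= E4 /= E3 [LHS]/= -[regs _ _]/(rg s2 8 0) -[X in _ %/ X]/(rg s2 rb 0).
  by rewrite !E2 /= E1 /= I1.
- by rewrite E5 /= I4'.
- by rewrite I5 I4'.
- by rewrite O5 O4 O3 O2 O1.
- rewrite pk_nil -vec0; apply: eq_vec => j _.
  by rewrite E5 /= E4 /= E3 /= E2 /= E1.
- by move=> l; exact: T0.
Qed.

(** Up to one unit, the running time bound at [N = k = 1]; the factor 2 comes from
    [k.+1 <= k * 2]. *)
Definition time_const c :=
  max_time init_prog + (1 + max_time (read_body c)).+1 + 2 + (cost (enz c vlast)).+2
  + (max_time read_k + (3 + max_time (load_body tPI)).+1 + 4
  + max_time load_X0 + (3 + max_time (load_body tX)).+1 + 4
  + max_time (first_bucket c)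
  + (cost (enz c vT) + ((3 + process_time c * 2).+1 + max_time (advance c))).+1
  + (cost (enz c vT)).+1 + max_time (first_output c)
  + (cost (enz c vT) + max_time (output_body c)).+1 + (cost (enz c vT)).+1).

Lemma time_bound c k N : 0 < k -> 0 < N ->
  max_time init_prog + (N * (1 + max_time (read_body c)).+1 + 2
    + (cost (enz c vlast) + count_time c k N).+1) <= time_const c * (N * k).
Proof.
move=> k0 N0; set M := N * k.
have M0 : 0 < M by rewrite muln_gt0 N0.
have cM x : x <= x * M by apply: leq_pmulr.
have NM x : N * x <= x * M by rewrite mulnC leq_mul2l leq_pmulr ?orbT.
have kM x : k * x <= x * M by rewrite mulnC leq_mul2l leq_pmull ?orbT.
have pM x : N * (3 + x * k.+1) <= (3 + x * 2) * M.
  rewrite mulnDr mulnDl leq_add //; rewrite /M mulnCA -!mulnA leq_mul2l.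
  by apply/orP; right; rewrite mulnCA leq_mul2l; apply/orP; right; move: k0; clear; lia.
rewrite /count_time /time_const.
move: (max_time init_prog) (max_time (read_body c)) (cost (enz c vlast))
  (max_time read_k) (max_time (load_body tPI)) (max_time load_X0)
  (max_time (load_body tX)) (max_time (first_bucket c)) (cost (enz c vT))
  (process_time c) (max_time (advance c)) (max_time (first_output c))
  (max_time (output_body c)) => a1 a2 a3 a4 a5 a6 a7 a8 a9 p a10 a11 a12.
(* Each summand is a constant times 1, [k], [N] or [N * k.+1]; bounding them one by one leaves a
   linear inequality. *)
have := cM a1; have := NM a2.+2; have := cM 2; have := cM a3.+2; have := cM a4.
have := kM (3 + a5).+1; have := cM 4; have := cM a6; have := kM (3 + a7).+1.
have := cM a8; have := pM p; have := NM a9; have := NM a10; have := NM 2.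
have := cM a9.+1; have := cM a11; have := NM (a9 + a12).+1.
clear; rewrite !mulnDl !mulnDr !mulnS; lia.
Qed.

Lemma prog_spec c w b n k pi (X : {set 'I_k.+1}) D :
  b <= w -> n < 2 ^ b -> n <= c * (w %/ b) ->
  0 < k -> k < 2 ^ w -> is_perm k pi ->
  uniq D -> all (in_Sle n) D -> downset D ->
  runs w (prog c) (time_const c * maxn 1 (size D * k))
    (init_state (input_tape w b c n pi X D)) (fun s => out s = output_tape w c pi X D).
Proof.
move=> bw nb ncB k0 kW pp uD aD dD.
set rest := k :: pi ++ [seq nat_of_bool (x \in X) | x <- enum 'I_k.+1].
have -> : input_tape w b c n pi X D = [:: w, b, n & tape w b c D rest] by [].
case: (eqVneq D [::]) => [->|D0].
  apply: (@runs_weaken _ _ (max_time init_prog + (0 * (1 + max_time (read_body c)).+1 + 2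
    + (cost (enz c vlast) + 1).+1)) _ _ (fun s => out s = [::])) => [||s -> //]; last first.
    by rewrite mul0n maxn0 muln1 /time_const; clear; lia.
  apply: runs_seq; apply: runs_straight => //; apply: init_spec => s R0.
  apply: runs_seq; apply: runs_weaken (leqnn _) _.
    apply: (runs_while (I := fun m s' => m = 0 /\ s' = s)) => [m s' []|s' [_ ->]|] //.
    by rewrite -[eval _ _ _]/(rg s rL 0) (ri_L R0).
  move=> _ [_ ->]; apply: runs_if.
    by rewrite ev_nz (ri_last R0) pk_nil eqxx.
  move=> _; exists 1, s; split; [exact: ExecSkip|by []|exact: ri_out R0].
have N0 : 0 < size D by rewrite lt0n size_eq0.
(* [b = 0] would force [n = 0], and then [D] would be empty. *)
have b0 : 0 < b.
  case: b nb {ncB bw rest} => // n1; case: D D0 aD {uD dD N0} => //= d D _.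
  by move: n1; rewrite expn0 ltnS leqn0 => /eqP -> /andP [/and3P []]; case: (size d).
rewrite (maxn_idPr _) ?muln_gt0 ?N0 //.
apply: runs_weaken (time_bound c k0 N0) (fun _ h => h).
apply: runs_seq; apply: runs_straight => //; apply: init_spec => s R0.
apply: runs_seq; apply: runs_weaken (leqnn _) _.
  apply: (runs_while (I := fun m s' => exists E1 E2,
    size E2 = m /\ read_inv w b c D rest E1 E2 s')) => [m s'|s'|].
  - case=> E1 [[|d E2] [//= [sE] R]]; split.
      rewrite -[regs _ _]/(rg s' rL 0) (ri_L R) /= -lt0n.
      have dD' : d \in D by rewrite (ri_D R) mem_cat mem_head orbT.
      by have /and3P [] := allP aD _ dD'.
    apply: runs_weaken (read_step bw nb ncB b0 uD aD R) (leqnn _) _ => s1 R1.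
    by exists (rcons E1 d), E2.
  - by case=> E1 [[|d E2] [sE R]] //; rewrite -[eval _ _ _]/(rg s' rL 0) (ri_L R).
  - by exists [::], D.
move=> s1 [E1 [[|d E2] [sE R]]] //; have E1D := ri_D R; rewrite cats0 in E1D.
rewrite -E1D in R; apply: runs_if => h.
  exact: (count_spec bw nb ncB b0 k0 kW pp uD aD dD D0 R).
have : last [::] D \in D.
  by case: (D) D0 => //= d D' _; rewrite mem_last.
move=> /(pkd_eq0 bw nb ncB b0 aD); rewrite -(ri_last R) -(ev_nz w c s1 vlast) h.
by [].
Qed.

(* One program and one constant, depending only on the number c of machine words
   that hold a permutation, serve all word sizes, patterns and downsets. The
   [maxn 1] only matters for D empty. *)
Theorem theorem9p3 (c : nat) (hc : 0 < c) :
  exists (p : cmd) (C : nat),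
  forall (w b n k : nat) (pi : seq nat) (X : {set 'I_k.+1})
         (D : seq (seq nat)),
    b <= w -> n < 2 ^ b -> n <= c * (w %/ b) ->
    0 < k -> k < 2 ^ w -> is_perm k pi ->
    uniq D -> all (in_Sle n) D -> downset D ->
    exists (t : nat) (s : state),
      [/\ exec w p (init_state (input_tape w b c n pi X D)) t s,
          out s = output_tape w c pi X D
        & t <= C * maxn 1 (size D * k)].
Proof.
exists (prog c), (time_const c) => w b n k pi X D bw nb ncB k0 kW pp uD aD dD.
have [t [s [ex le ho]]] := prog_spec X bw nb ncB k0 kW pp uD aD dD.
by exists t, s.
Qed.
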